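(* Let $A$ be a $C^*$-algebra and let $S\subset A$ be a closed subspace which is reflexive (as a Banach space) and complemented in $A$. Then $S$ is isomorphic to a Hilbert space, i.e. there is a Hilbert space $K$ and a bounded linear bijection $S\to K$ with bounded inverse.
   Context: A closed subspace $S$ of a Banach space $A$ is called complemented if there is a bounded linear projection $P:A\to A$ with range $S$ (no assumption on the norm of $P$). *)

(* Defs.v *)
From HB Require Import structures.
From mathcomp Require Import all_boot all_order all_algebra.
From mathcomp Require Import complex.
From mathcomp Require Import all_classical all_reals all_analysis.

Set Implicit Arguments.
Unset Strict Implicit.
Unset Printing Implicit Defensive.

Import Order.TTheory GRing.Theory Num.Theory.
Import numFieldNormedType.Exports.

Local Open Scope classical_set_scope.
Local Open Scope complex_scope.
Local Open Scope ring_scope.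

Section bounded.
Context {R : realType} {E F : normedModType R[i]}.

Definition bounded_map (f : E -> F) : Prop :=
  exists M : R, forall x, `|f x| <= M%:C * `|x|.

End bounded.

Section dual.
Context {R : realType} (E : normedModType R[i]).
Local Notation C := R[i].

Lemma real_complexD (x y : R) : (x + y)%:C = x%:C + y%:C :> C.
Proof. exact: rmorphD. Qed.

Lemma real_complexM (x y : R) : (x * y)%:C = x%:C * y%:C :> C.
Proof. exact: rmorphM. Qed.

Lemma complex_Re_norm (z : C) : (complex.Re `|z|)%:C = `|z|.
Proof. by rewrite RRe_real ?normr_real. Qed.

Lemma complex_Re_norm_ge0 (z : C) : 0 <= complex.Re `|z|.
Proof. by have := normr_ge0 z; rewrite lecE => /andP[]. Qed.

Definition bounded_functional : {pred E -> C^o} :=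
  [pred f : E -> C^o | `[< linear f /\ bounded_map f >]].

Lemma bounded_functional_submod_closed : submod_closed bounded_functional.
Proof.
split.
  apply/asboolP; split; first by move=> a x y; rewrite -[0 _]/(0 : C^o) scaler0 addr0.
  by exists 0 => x; rewrite -[X in `|X|]/(0 : C^o) normr0 mul0r.
move=> a f g /asboolP[lf [M fM]] /asboolP[lg [N gN]]; apply/asboolP; split.
  move=> b x y; rewrite !fctE lf lg !scalerDr !scalerA (mulrC b a).
  by rewrite !addrA; congr (_ + _); rewrite addrAC.
exists (complex.Re `|a| * M + N) => x; rewrite !fctE.
rewrite (le_trans (ler_normD _ _))// normrZ real_complexD real_complexM.
rewrite complex_Re_norm mulrDl lerD// -mulrA.
exact: ler_wpM2l.
Qed.

HB.instance Definition _ := GRing.isSubmodClosed.Build _ _ bounded_functional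
  bounded_functional_submod_closed.

Definition dual : Type := {f : E -> C^o | f \in bounded_functional}.

HB.instance Definition _ := [isSub of dual for @sval _ _].
HB.instance Definition _ := [Choice of dual by <:].
HB.instance Definition _ := [SubChoice_isSubLmodule of dual by <:].

Definition dual_fun (f : dual) : E -> C := val f.
Coercion dual_fun : dual >-> Funclass.

(* Operator norm.  Norms of normed modules over R[i] are nonnegative elements
   of R[i]; the supremum is taken in R. *)
Definition dual_norm (f : dual) : C :=
  (sup [set complex.Re `|f x| | x in [set x : E | `|x| <= 1]])%:C.

Lemma complex_ReM (M : R) (z : C) : complex.Re (M%:C * z) = M * complex.Re z.
Proof. by case: z => a b /=; rewrite mul0r subr0. Qed.

Lemma complex_ReD (y z : C) : complex.Re (y + z) = complex.Re y + complex.Re z.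
Proof. by case: y; case: z. Qed.

Lemma le_complex_Re (y z : C) : y <= z -> complex.Re y <= complex.Re z.
Proof. by rewrite lecE => /andP[]. Qed.

Lemma dual_linear (f : dual) : linear (f : E -> C^o).
Proof. by have /asboolP[] := valP f. Qed.

Lemma dual_bounded (f : dual) : bounded_map (f : E -> C^o).
Proof. by have /asboolP[] := valP f. Qed.

Lemma dual_fun0 (f : dual) : f 0 = 0.
Proof. by have := dual_linear f (-1) 0 0; rewrite scaler0 addr0 scaleN1r addNr. Qed.

Lemma dual_norm_has_sup (f : dual) :
  has_sup [set complex.Re `|f x| | x in [set x : E | `|x| <= 1]].
Proof.
split; first by exists (complex.Re `|f 0|), 0 => //=; rewrite normr0.
have [M fM] := dual_bounded f; exists `|M| => _ [x /= x1 <-].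
rewrite (le_trans (le_complex_Re (fM x)))// complex_ReM.
rewrite (le_trans (ler_norm _))// normrM -[leRHS]mulr1 ler_wpM2l//.
have Rex : 0 <= complex.Re `|x| by have := le_complex_Re (normr_ge0 x).
by rewrite ger0_norm//; have := le_complex_Re x1.
Qed.

Lemma dual_norm_ub (f : dual) (x : E) : `|x| <= 1 ->
  complex.Re `|f x| <= complex.Re (dual_norm f).
Proof.
move=> x1; apply: sup_upper_bound; first exact: dual_norm_has_sup.
by exists x.
Qed.

Lemma dual_normP (f : dual) (r : R) :
  (forall x : E, `|x| <= 1 -> complex.Re `|f x| <= r) ->
  complex.Re (dual_norm f) <= r.
Proof.
move=> fr; apply: ge_sup; first by have [] := dual_norm_has_sup f.
by move=> _ [x x1 <-]; exact: fr.
Qed.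

Lemma dual_normD (f g : dual) : dual_norm (f + g) <= dual_norm f + dual_norm g.
Proof.
rewrite -real_complexD lecR; apply: dual_normP => x x1.
rewrite (le_trans (le_complex_Re (ler_normD (f x) (g x))))// complex_ReD.
by rewrite lerD// dual_norm_ub.
Qed.

Lemma dual_normZ_le (a : C) (f : dual) :
  dual_norm (a *: f) <= `|a| * dual_norm f.
Proof.
rewrite -(complex_Re_norm a) -real_complexM lecR; apply: dual_normP => x x1.
have -> : dual_fun (a *: f) x = a * f x by [].
rewrite normrM -[X in complex.Re (X * _)](complex_Re_norm a) complex_ReM.
by rewrite ler_wpM2l ?complex_Re_norm_ge0//; exact: (dual_norm_ub f x1).
Qed.

Lemma dual_normZ (a : C) (f : dual) : dual_norm (a *: f) = `|a| * dual_norm f.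
Proof.
apply/eqP; rewrite eq_le dual_normZ_le/=.
have [->|a0] := eqVneq a 0.
  rewrite normr0 mul0r lecR (le_trans (complex_Re_norm_ge0 (dual_fun (0 *: f) 0)))//.
  by rewrite dual_norm_ub// normr0.
have := dual_normZ_le a^-1 (a *: f).
by rewrite scalerA mulVf// scale1r normfV ler_pdivlMl// normr_gt0.
Qed.

Lemma dual_norm_eq0 (f : dual) : dual_norm f = 0 -> f = 0.
Proof.
move=> f0; apply/val_inj/funext => x; apply/eqP; rewrite -[_ == _]/(f x == 0).
have [->|x0] := eqVneq x 0; first by rewrite dual_fun0.
have lx : f (`|x|^-1 *: x) = `|x|^-1 * f x.
  by have := dual_linear f (`|x|^-1) x 0; rewrite !addr0 dual_fun0 addr0.
have : `|f (`|x|^-1 *: x)| <= 0.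
  rewrite -complex_Re_norm -f0 lecR; apply: dual_norm_ub.
  by rewrite normrZ normfV normr_id mulVf// normr_eq0.
by rewrite normr_le0 lx mulf_eq0 invr_eq0 normr_eq0 (negPf x0).
Qed.

HB.instance Definition _ :=
  Lmodule_isNormed.Build C dual dual_normD dual_normZ dual_norm_eq0.

End dual.

Definition reflexive_space {R : realType} (E : normedModType R[i]) : Prop :=
  forall phi : dual (dual E), exists x : E, forall f : dual E, phi f = f x.

Section subspace_of.
Context {R : realType} {A : normedModType R[i]} {S : set A}.

(* S as a predicate, indexed by the proof that it is a linear subspace so that
   the instances below can be inferred. *)
Definition subspace_pred of submod_closed [in S] : {pred A} := [in S].

Variable linS : submod_closed [in S].

HB.instance Definition _ :=
  GRing.isSubmodClosed.Build _ _ (subspace_pred linS) linS.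

Definition subspace_of : Type := {x : A | x \in subspace_pred linS}.

HB.instance Definition _ := [isSub of subspace_of for @sval _ _].
HB.instance Definition _ := [Choice of subspace_of by <:].
HB.instance Definition _ := [SubChoice_isSubLmodule of subspace_of by <:].

Definition subspace_norm (x : subspace_of) : R[i] := `|val x|.

Lemma subspace_normD x y : subspace_norm (x + y) <= subspace_norm x + subspace_norm y.
Proof. exact: ler_normD. Qed.

Lemma subspace_normZ (a : R[i]) x : subspace_norm (a *: x) = `|a| * subspace_norm x.
Proof. exact: normrZ. Qed.

Lemma subspace_norm_eq0 x : subspace_norm x = 0 -> x = 0.
Proof. by move=> /normr0_eq0 x0; exact/val_inj. Qed.

HB.instance Definition _ := Lmodule_isNormed.Build R[i] subspace_of
  subspace_normD subspace_normZ subspace_norm_eq0.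

End subspace_of.

(* No unit is assumed, so the product cannot come from a MathComp ring. *)
HB.mixin Record isCStarAlgebra (R : realType) A & CompleteNormedModule R[i] A := {
  cmul : A -> A -> A;
  cstar : A -> A;
  cmulA : associative cmul;
  cmulDl : left_distributive cmul +%R;
  cmulDr : right_distributive cmul +%R;
  cmulZl : forall (a : R[i]) (x y : A), cmul (a *: x) y = a *: cmul x y;
  cmulZr : forall (a : R[i]) (x y : A), cmul x (a *: y) = a *: cmul x y;
  norm_cmul_le : forall x y : A, `|cmul x y| <= `|x| * `|y|;
  cstarK : involutive cstar;
  cstarD : {morph cstar : x y / x + y};
  cstarZ : forall (a : R[i]) (x : A), cstar (a *: x) = conjc a *: cstar x;
  cstarM : forall x y : A, cstar (cmul x y) = cmul (cstar y) (cstar x);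
  norm_cstar_cmul : forall x : A, `|cmul (cstar x) x| = `|x| ^+ 2
}.

#[short(type="cstarAlgType")]
HB.structure Definition CStarAlgebra (R : realType) :=
  {A of CompleteNormedModule R[i] A & isCStarAlgebra R A}.

Definition complemented {R : realType} {A : normedModType R[i]} (S : set A) : Prop :=
  exists P : {linear A -> A},
    [/\ bounded_map P, idempotent_fun P & range P = S].

Definition hilbert_space {R : realType} (K : completeNormedModType R[i]) : Prop :=
  exists dot : {dot K for @conjc R}, forall x : K, `|x| ^+ 2 = dot x x.

Definition isomorphic {R : realType} (E F : normedModType R[i]) : Prop :=
  exists (T : {linear E -> F}) (T' : F -> E),
    [/\ bounded_map T, cancel T T', cancel T' T & bounded_map T'].

(* Main.v *)
Require Import Defs.
From HB Require Import structures.
From Stdlib Require Ncring Ncring_tac.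
From mathcomp Require Import all_boot all_order all_algebra.
From mathcomp Require Import complex.
From mathcomp Require Import all_classical all_reals all_analysis.
From mathcomp Require Import ring lra.

Set Implicit Arguments.
Unset Strict Implicit.
Unset Printing Implicit Defensive.

Import Order.TTheory GRing.Theory Num.Theory.
Import numFieldNormedType.Exports.

Local Open Scope classical_set_scope.
Local Open Scope complex_scope.
Local Open Scope ring_scope.

(** The norm of [S] is shown to be equivalent to [x |-> phi (star x * x +
    x * star x) ^ (1/2)] for some bounded positive functional [phi]; this is a
    Hilbert norm.  Since [phi] is bounded, only the lower bound
    [e * |x| ^ 2 <= phi (star x * x + x * star x)] on [S] needs an argument, and
    this is where reflexivity enters.

    Suppose that no [phi] works.  Then, however large [phi] is, [S] contains unit
    vectors [x] at which [phi (star x * x + x * star x)] is as small as desired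
    (in the commutative case: functions of norm one concentrated on sets of tiny
    measure).  Every bounded functional [g] on the algebra satisfies
    [|g w| ^ 2 <= phi (w * star w)] and [|g w| ^ 2 <= phi (star w * w)] for some
    [phi] (lemma [dominated]), so smallness for [phi] entails smallness for any
    finite number of functionals given beforehand.  Choosing such vectors [x_n]
    one after the other, build a gliding hump
    [Y_n = (1 - b_n) Y_(n-1) (1 - b_n) +- b_n x_n b_n],
    where the cutoff [b_n] (lemma [cutoff]) is small for the [phi] of the previous
    stages and yet [b_n x_n b_n] is close to [x_n].  The [Y_n] stay in the unit
    ball (lemma [nrm_sandwich]) and the functionals chosen before stage [n]
    hardly notice the change from [Y_(n-1)] to [Y_n].  If [P] is the projection,
    the sign can be chosen so that [P Y_n] is at distance at least 1/8 from the
    combinations of the previous [P Y_j] with coefficients in [-1, 1], because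
    [x_n = P x_n] is far from them (lemmas [small_far] and [stage_nextP]); a
    functional [f_n] that realises this separation is then recorded.

    By reflexivity the bounded sequence [P Y_n] has a weak limit [y] (lemma
    [reflexive_weak_limit]), which by separation is a norm limit of combinations
    [v] of the [P Y_j].  For large [n] the value [f_n y] is close to [f_n (P Y_n)],
    which exceeds [f_n v] by 1/8, although [y] and [v] are close: a contradiction
    (lemma [small_absurd]).

    The functionals all come from the theorem [mazur_orlicz], a form of the
    Hahn-Banach theorem that produces a linear functional satisfying a cone of
    lower bounds.  The order theory of C*-algebras is derived from one fact: a
    self-adjoint [h] with [|h| <= 1] is the square of a self-adjoint element if
    and only if [|1 - h| <= 1] (lemmas [pos_one_minus] and [nrm_one_minus]).  It
    makes the squares a convex cone on which the norm is monotone, and leads to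
    the positivity of [star x * x] (lemma [pos_starM]).  It takes place in a
    unital algebra, so the given algebra is first embedded in its unitization. *)

(** * Real-linear functionals and the Mazur-Orlicz theorem *)

Section mazur_orlicz.
Context {R : realType}.
Implicit Type V : lmodType R[i].

Definition real_linear V (f : V -> R) :=
  (forall x y, f (x + y) = f x + f y) /\ (forall t x, f (t%:C *: x) = t * f x).

Definition sublinear V (q : V -> R) :=
  (forall x y, q (x + y) <= q x + q y) /\
  (forall t x, 0 <= t -> q (t%:C *: x) = t * q x).

(** A pair [(c, r)] of the cone is read as the constraint [r <= f c] on a
    functional [f]; sums and positive multiples of constraints are again
    constraints. *)
Definition constraint_cone V (C : V -> R -> Prop) :=
  [/\ C 0 0, forall c r d s, C c r -> C d s -> C (c + d) (r + s) &
      forall t c r, 0 <= t -> C c r -> C (t%:C *: c) (t * r)].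

Lemma half_split V (x : V) : x = (2^-1)%:C *: (x + x).
Proof.
rewrite scalerDr -scalerDl -rmorphD; have -> : 2^-1 + 2^-1 = 1 :> R by lra.
by rewrite rmorph1 scale1r.
Qed.

Lemma real_linearN V (f : V -> R) x : real_linear f -> f (- x) = - f x.
Proof.
move=> [_ fZ]; have := fZ (-1) x.
by rewrite rmorphN rmorph1 scaleN1r mulN1r.
Qed.

Lemma real_linearB V (f : V -> R) x y : real_linear f -> f (x - y) = f x - f y.
Proof. by move=> lf; rewrite lf.1 real_linearN. Qed.

Lemma real_linear0 V (f : V -> R) : real_linear f -> f 0 = 0.
Proof. by move=> lf; rewrite -(subrr 0) real_linearB// subrr. Qed.

Lemma real_linear_sum V (f : V -> R) I (r : seq I) (F : I -> V) :
  real_linear f -> f (\sum_(i <- r) F i) = \sum_(i <- r) f (F i).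
Proof.
move=> lf; elim: r => [|a r IH]; first by rewrite !big_nil real_linear0.
by rewrite !big_cons lf.1 IH.
Qed.

Lemma sublinear0 V (q : V -> R) : sublinear q -> q 0 = 0.
Proof. by move=> [_ qZ]; rewrite -(scale0r (0 : V)) -(rmorph0 (real_complex R)) qZ// mul0r. Qed.

Lemma sublinear_geN V (q : V -> R) x : sublinear q -> - q (- x) <= q x.
Proof.
move=> qs; have := qs.1 x (- x); rewrite subrr (sublinear0 qs) => ?.
by rewrite lerNl -subr_ge0 opprK addrC.
Qed.

(** A sublinear functional stays sublinear when it is lowered just enough to
    enforce a cone of constraints that it satisfies. *)
Lemma sublinear_lower V (q : V -> R) (C : V -> R -> Prop) :
  sublinear q -> constraint_cone C -> (forall c r, C c r -> r <= q c) ->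
  exists q' : V -> R, [/\ sublinear q', forall x, q' x <= q x &
    forall c r, C c r -> q' (- c) <= - r].
Proof.
move=> qs [C0 CD CZ] Cq.
pose A x := [set a | exists c r, C c r /\ a = q (x + c) - r].
pose q' x := inf (A x).
have A0 x : A x !=set0 by exists (q (x + 0) - 0), 0, 0.
have Alb x : has_lbound (A x).
  exists (- q (- x)) => _ [c [r [Ccr ->]]].
  have := qs.1 (x + c) (- x); rewrite addrAC subrr add0r.
  by have := Cq _ _ Ccr; lra.
have q'le x c r : C c r -> q' x <= q (x + c) - r.
  by move=> Ccr; apply: ge_inf => //; exists c, r.
have q'ge x b : (forall c r, C c r -> b <= q (x + c) - r) -> b <= q' x.
  by move=> H; apply: lb_le_inf => // _ [c [r [Ccr ->]]]; exact: H.
have q'0 : q' 0 = 0.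
  apply/eqP; rewrite eq_le; apply/andP; split.
    by have := q'le 0 0 0 C0; rewrite addr0 (sublinear0 qs) subr0.
  by apply: (q'ge) => c r /Cq; rewrite add0r subr_ge0.
have q'Z t x : 0 < t -> q' (t%:C *: x) <= t * q' x.
  move=> t0; rewrite -ler_pdivrMl//; apply: (q'ge) => c r Ccr.
  rewrite ler_pdivrMl// mulrBr -(qs.2 _ _ (ltW t0)) scalerDr.
  by apply: (q'le); apply: CZ => //; exact: ltW.
exists q'; split => [|x|c r Ccr].
- split=> [x y|t x].
    rewrite -lerBlDr; apply: (q'ge) => c r Ccr.
    rewrite lerBlDr -lerBlDl; apply: (q'ge) => d s Cds.
    rewrite lerBlDl; apply: le_trans (q'le _ _ _ (CD _ _ _ _ Ccr Cds)) _.
    have := qs.1 (x + c) (y + d); rewrite addrACA; lra.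
  rewrite le_eqVlt => /predU1P[<-|t0]; first by rewrite scale0r mul0r.
  apply/eqP; rewrite eq_le q'Z//=.
  have ti0 : 0 < t^-1 by rewrite invr_gt0.
  rewrite -ler_pdivlMl//; apply: le_trans (q'Z _ _ ti0).
  by rewrite scalerA -rmorphM mulVf ?gt_eqF// scale1r.
- by have := q'le x 0 0 C0; rewrite addr0 subr0.
- by have := q'le (- c) c r Ccr; rewrite addNr (sublinear0 qs) sub0r.
Qed.

(** The pointwise infimum of a chain of sublinear functionals is sublinear, and
    [- p (- x)] keeps it finite, so Zorn's lemma applies. *)
Lemma sublinear_minorant V (p : V -> R) : sublinear p ->
  exists q : V -> R, [/\ sublinear q, forall x, q x <= p x &
    forall q', sublinear q' -> (forall x, q' x <= q x) -> forall x, q x <= q' x].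
Proof.
move=> ps; pose T := {q : V -> R | sublinear q /\ forall x, q x <= p x}.
have ps' : sublinear p /\ forall x, p x <= p x by [].
pose t0 : T := exist _ p ps'.
pose r (a b : T) := `[< forall x, sval b x <= sval a x >].
have [//|||[q [qs qp]] qmax] := @ZL_preorder T t0 r.
- by move=> t; apply/asboolP.
- move=> a b c /asboolP ab /asboolP bc; apply/asboolP => x.
  exact: le_trans (bc x) (ab x).
- move=> A Atot.
  have [A0|[a Aa]] : A = set0 \/ A !=set0 by have [->|/set0P] := eqVneq A set0; [left|right].
    by exists t0 => s; rewrite A0.
  pose B x := [set sval s x | s in A].
  have B0 x : B x !=set0 by exists (sval a x), a.
  have Blb x : has_lbound (B x).
    exists (- p (- x)) => _ [[s [ss sp]] As <-] /=.
    by apply: le_trans (sublinear_geN _ ss); rewrite lerN2.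
  pose m x := inf (B x).
  have mle x s : A s -> m x <= sval s x by move=> As; apply: ge_inf => //; exists s.
  have mge x b : (forall s, A s -> b <= sval s x) -> b <= m x.
    by move=> H; apply: lb_le_inf => // _ [s As <-]; exact: H.
  have ms : sublinear m.
    split=> [x y|t x].
      rewrite -lerBlDr; apply: (mge) => s As.
      rewrite lerBlDr -lerBlDl; apply: (mge) => s' As'; rewrite lerBlDl.
      have [/asboolP ss'|/asboolP s's] := Atot _ _ As As'.
        apply: le_trans (mle _ _ As') _; apply: le_trans ((svalP s').1.1 _ _) _.
        by apply: lerD => //; exact: ss'.
      apply: le_trans (mle _ _ As) _; apply: le_trans ((svalP s).1.1 _ _) _.
      by apply: lerD => //; exact: s's.
    rewrite le_eqVlt => /predU1P[<-|t0'].
      rewrite scale0r mul0r; apply/eqP; rewrite eq_le; apply/andP; split.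
        by have := mle 0 _ Aa; rewrite (sublinear0 (svalP a).1).
      by apply: (mge) => s _; rewrite (sublinear0 (svalP s).1).
    apply/eqP; rewrite eq_le; apply/andP; split.
      rewrite -ler_pdivrMl//; apply: (mge) => s As.
      by rewrite ler_pdivrMl// -((svalP s).1.2 _ _ (ltW t0')); exact: mle.
    apply: (mge) => s As; rewrite ((svalP s).1.2 _ _ (ltW t0')); apply: ler_wpM2l (mle _ _ As); exact: ltW.
  have mp : sublinear m /\ forall x, m x <= p x.
    by split=> // x; apply: le_trans (mle _ _ Aa) ((svalP a).2 x).
  by exists (exist _ m mp) => s As; apply/asboolP => x; exact: mle.
exists q; split => // q' q's q'q x.
have q'p : sublinear q' /\ forall x, q' x <= p x.
  by split=> // y; exact: le_trans (q'q y) (qp y).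
by have /asboolP := qmax (exist _ q' q'p) (introT (asboolP _) q'q); apply.
Qed.

(** A minimal sublinear functional [q] is linear: lowering it so as to enforce
    [q y <= f y] changes nothing, hence [q (- y) <= - q y]. *)
Theorem mazur_orlicz V (p : V -> R) (C : V -> R -> Prop) :
  sublinear p -> constraint_cone C -> (forall c r, C c r -> r <= p c) ->
  exists f : V -> R, [/\ real_linear f, forall x, f x <= p x &
    forall c r, C c r -> r <= f c].
Proof.
move=> ps CC Cp; have [p' [p's p'p Cp']] := sublinear_lower ps CC Cp.
have [q [qs qp' qmin]] := sublinear_minorant p's.
have qN y : q (- y) = - q y.
  apply/eqP; rewrite eq_le; apply/andP; split; last first.
    by have := sublinear_geN (- y) qs; rewrite opprK.
  pose D c r := exists2 t, 0 <= t & c = t%:C *: y /\ r = t * q y.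
  have [|_ _ [t t0 [-> ->]]|q' [q's q'q]] := @sublinear_lower _ q D qs.
  - split=> [|_ _ _ _ [t t0 [-> ->]] [s s0 [-> ->]]|t _ _ t0 [s s0 [-> ->]]].
    + by exists 0 => //; rewrite scale0r mul0r.
    + by exists (t + s); [exact: addr_ge0|rewrite rmorphD scalerDl mulrDl].
    + by exists (t * s); [exact: mulr_ge0|rewrite rmorphM scalerA mulrA].
  - by rewrite qs.2.
  move=> /(_ y (q y)) Dq'; apply: le_trans (qmin _ q's q'q _) (Dq' _).
  by exists 1; rewrite ?ler01// scale1r mul1r.
exists q; split => [|x|c r Ccr].
- split=> [x y|t x].
    apply/eqP; rewrite eq_le qs.1/= -lerN2 -qN opprD.
    by have := qs.1 (- x) (- y); rewrite !qN; lra.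
  have [t0|t0] := leP 0 t; first by rewrite qs.2.
  rewrite -[LHS]opprK -qN -scaleNr -rmorphN qs.2; last by rewrite oppr_ge0 ltW.
  by rewrite mulNr opprK.
- exact: le_trans (qp' x) (p'p x).
- rewrite -lerN2 -qN; apply: le_trans (qp' _) _; exact: Cp'.
Qed.

(** The complex-linear functional whose real part is [f]. *)
Definition complexify V (f : V -> R) (x : V) : R[i] := (f x -i* f ('i%C *: x))%C.

Lemma complexify_linear V (f : V -> R) : real_linear f ->
  linear (complexify f : V -> R[i]^o).
Proof.
move=> lf [p q] x y.
have e1 : (p +i* q)%C *: x = p%:C *: x + q%:C *: ('i%C *: x).
  by rewrite scalerA -scalerDl; congr (_ *: _); simpc.
have e2 : 'i%C *: ((p +i* q)%C *: x) = p%:C *: ('i%C *: x) - q%:C *: x.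
  rewrite !scalerA -scaleNr -scalerDl; congr (_ *: _); by simpc.
rewrite /complexify scalerDr e2 e1 !lf.1 -scaleNr -rmorphN !lf.2.
have sE (a z : R[i]) : a *: (z : R[i]^o) = a * z by [].
by rewrite sE; simpc; congr Complex; ring.
Qed.

End mazur_orlicz.

(** * Unital C*-algebras *)

(** The underlying ring and scalar structures are those of [GRing.Algebra], which
    makes ring notation and [non_commutative_ring] available.  The norm takes its
    values in [R], and completeness is stated for sequences only, since it serves
    once, to construct square roots. *)
HB.mixin Record isUnitalCStar (R : realType) B of GRing.Algebra R[i] B := {
  nrm : B -> R;
  star : B -> B;
  nrmD : forall x y : B, nrm (x + y) <= nrm x + nrm y;
  nrmZ : forall (a : R[i]) (x : B), nrm (a *: x) = complex.Re `|a| * nrm x;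
  nrm_eq0 : forall x : B, nrm x = 0 -> x = 0;
  nrmM : forall x y : B, nrm (x * y) <= nrm x * nrm y;
  starK : involutive star;
  starD : {morph star : x y / x + y};
  starZ : forall (a : R[i]) (x : B), star (a *: x) = conjc a *: star x;
  starM : forall x y : B, star (x * y) = star y * star x;
  nrm_starM : forall x : B, nrm (star x * x) = nrm x ^+ 2;
  nrm_complete : forall u : nat -> B,
    (forall e, 0 < e -> exists N : nat, forall m n : nat,
       (N <= m)%N -> (N <= n)%N -> nrm (u m - u n) <= e) ->
    exists l, forall e, 0 < e -> exists N : nat, forall n : nat,
       (N <= n)%N -> nrm (u n - l) <= e
}.

#[short(type="unitalCStarType")]
HB.structure Definition UnitalCStar (R : realType) :=
  {B of GRing.Algebra R[i] B & isUnitalCStar R B}.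

(** These instances let [non_commutative_ring] normalise identities. *)
#[global] Instance mathcomp_Ncring_ops (B : pzRingType) :
  @Ncring.Ring_ops B 0 1 +%R *%R (fun x y => x - y) -%R eq := {}.

#[global] Instance mathcomp_Ncring (B : pzRingType) :
  Ncring.Ring (Ro := mathcomp_Ncring_ops B).
Proof.
split; try exact _; [ exact: add0r | exact: addrC | exact: addrA | exact: mul1r
| exact: mulr1 | exact: mulrA | exact: mulrDl | by move=> x y z; exact: mulrDr
| by [] | exact: subrr ].
Qed.

Section unital_cstar.
Context {R : realType} {B : unitalCStarType R}.
Implicit Types (x y z h k : B) (s t : R).

Lemma normc_real t : complex.Re `|t%:C| = `|t|.
Proof. by rewrite normc_def/= expr0n/= addr0 sqrtr_sqr. Qed.

Lemma nrmZr t x : nrm (t%:C *: x) = `|t| * nrm x.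
Proof. by rewrite nrmZ normc_real. Qed.

Lemma nrm0 : nrm (0 : B) = 0.
Proof. by rewrite -(scale0r 0) nrmZ normr0 mul0r. Qed.

Lemma nrmN x : nrm (- x) = nrm x.
Proof. by rewrite -scaleN1r nrmZ normrN1 mul1r. Qed.

Lemma nrm_ge0 x : 0 <= nrm x.
Proof. by have := nrmD x (- x); rewrite subrr nrm0 nrmN; lra. Qed.

Lemma nrmB x y : nrm (x - y) <= nrm x + nrm y.
Proof. by rewrite -(nrmN y); exact: nrmD. Qed.

Lemma nrmBC x y : nrm (x - y) = nrm (y - x).
Proof. by rewrite -nrmN opprB. Qed.

Lemma nrmM_le x y s t : nrm x <= s -> nrm y <= t -> nrm (x * y) <= s * t.
Proof.
by move=> xs yt; apply: le_trans (nrmM _ _) _; apply: ler_pM => //; exact: nrm_ge0.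
Qed.

Lemma nrm_small x K : (forall e, 0 < e -> nrm x <= K * e) -> x = 0.
Proof.
move=> H; apply: nrm_eq0; apply/eqP; rewrite eq_le nrm_ge0 andbT.
apply/ler_addgt0Pl => e e0; rewrite addr0.
have K0 : 0 < `|K| + 1 by rewrite ltr_wpDl.
apply: le_trans (H (e / (`|K| + 1)) (divr_gt0 e0 K0)) _.
rewrite mulrCA ger_pMr// ler_pdivrMr// mul1r.
by rewrite (le_trans (ler_norm K))// lerDl.
Qed.

Lemma star0 : star (0 : B) = 0.
Proof. by rewrite -(scale0r 0) starZ conjc0 !scale0r. Qed.

Lemma starN x : star (- x) = - star x.
Proof. by rewrite -scaleN1r starZ rmorphN1 scaleN1r. Qed.

Lemma starB x y : star (x - y) = star x - star y.
Proof. by rewrite starD starN. Qed.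

Lemma starZr t x : star (t%:C *: x) = t%:C *: star x.
Proof. by rewrite starZ conjc_real. Qed.

Lemma star1 : star (1 : B) = 1.
Proof. by rewrite -[star 1]mulr1 -{2}(starK 1) -starM mulr1 starK. Qed.

Lemma nrm_star x : nrm (star x) = nrm x.
Proof.
suff H y : nrm y <= nrm (star y).
  by apply/eqP; rewrite eq_le H andbT; have := H (star x); rewrite starK.
have [y0|y0] := eqVneq (nrm y) 0; first by rewrite y0 nrm_ge0.
have yp : 0 < nrm y by rewrite lt_neqAle eq_sym y0 nrm_ge0.
by rewrite -(ler_pM2r yp) -expr2 -nrm_starM nrmM.
Qed.

Lemma nrm_Mstar x : nrm (x * star x) = nrm x ^+ 2.
Proof. by rewrite -{1}(starK x) nrm_starM nrm_star. Qed.

Lemma nrm_sqr_le x t : 0 <= t -> nrm (star x * x) <= t ^+ 2 -> nrm x <= t.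
Proof. by move=> t0; rewrite nrm_starM ler_sqr ?nnegrE ?nrm_ge0. Qed.

Lemma nrm1 : nrm (1 : B) = 1.
Proof.
have := nrm_starM (1 : B); rewrite star1 mulr1 expr2 => /eqP.
rewrite -{1}[nrm 1]mulr1 -subr_eq0 -mulrBr mulf_eq0 => /orP[/eqP/nrm_eq0/eqP|].
  by rewrite oner_eq0.
by rewrite subr_eq0 => /eqP.
Qed.

Definition sa x := star x = x.

Lemma saD x y : sa x -> sa y -> sa (x + y).
Proof. by rewrite /sa starD => -> ->. Qed.

Lemma saB x y : sa x -> sa y -> sa (x - y).
Proof. by rewrite /sa starB => -> ->. Qed.

Lemma saZ t x : sa x -> sa (t%:C *: x).
Proof. by rewrite /sa starZr => ->. Qed.

Lemma sa1 : sa 1. Proof. exact: star1. Qed.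

Lemma sa_sqr x : sa x -> sa (x * x).
Proof. by rewrite /sa starM => ->. Qed.

Lemma nrm_sa_sqr x : sa x -> nrm (x * x) = nrm x ^+ 2.
Proof. by move=> sx; rewrite -{1}sx nrm_starM. Qed.

Lemma scalerM s t x : s%:C *: (t%:C *: x) = (s * t)%:C *: x.
Proof. by rewrite scalerA -rmorphM. Qed.

(** ** The cone of squares of self-adjoint elements *)

(** The iteration [y <- (x + y ^ 2) / 2] from [0] converges even when
    [nrm x = 1]: its increments are dominated by those of the same iteration
    on the real number [1], which is increasing and bounded by [1].  Its limit
    [y] satisfies [(1 - y) ^ 2 = 1 - x]. *)
Lemma sqrt_one_minus x : nrm x <= 1 -> exists y,
  [/\ (1 - y) * (1 - y) = 1 - x, nrm y <= 1, sa x -> sa y &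
      forall z, z * x = x * z -> z * y = y * z].
Proof.
move=> x1.
pose u := fix u n := if n is m.+1 then (2^-1)%:C *: (x + u m * u m) else 0.
pose v := fix v n : R := if n is m.+1 then 2^-1 * (1 + v m * v m) else 0.
have v01 n : 0 <= v n <= 1.
  elim: n => [|n /andP[v0 v1]] /=; first by rewrite lexx ler01.
  by apply/andP; split; nra.
have uv n : nrm (u n) <= v n.
  elim: n => [|n IH] /=; first by rewrite nrm0.
  rewrite nrmZr ger0_norm ?invr_ge0// ler_wpM2l ?invr_ge0//.
  by apply: le_trans (nrmD _ _) _; apply: lerD => //; exact: nrmM_le.
have duv n : nrm (u n.+1 - u n) <= v n.+1 - v n.
  elim: n => [|n IH]; first by rewrite /= !subr0 (uv 1).
  rewrite {1}/u {1}/v -/u -/v -/(u n.+1) -/(v n.+1).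
  have -> : (2^-1)%:C *: (x + u n.+1 * u n.+1) - (2^-1)%:C *: (x + u n * u n)
     = (2^-1)%:C *: ((u n.+1 - u n) * u n.+1 + u n * (u n.+1 - u n)).
    by rewrite -scalerBr; congr (_ *: _); Ncring_tac.non_commutative_ring.
  rewrite nrmZr ger0_norm ?invr_ge0//.
  have -> : 2^-1 * (1 + v n.+1 * v n.+1) - 2^-1 * (1 + v n * v n)
     = 2^-1 * ((v n.+1 - v n) * v n.+1 + v n * (v n.+1 - v n)) by ring.
  rewrite ler_wpM2l ?invr_ge0//; apply: le_trans (nrmD _ _) _.
  by apply: lerD; apply: nrmM_le.
have duvk n (k : nat) : nrm (u (n + k)%N - u n) <= v (n + k)%N - v n.
  elim: k => [|k IH]; first by rewrite addn0 !subrr nrm0.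
  rewrite addnS -(subrKA (u (n + k)%N)) -[leRHS](subrKA (v (n + k)%N)).
  by apply: le_trans (nrmD _ _) _; apply: lerD.
have vmono n (k : nat) : v n <= v (n + k)%N.
  by have := le_trans (nrm_ge0 _) (duvk n k); rewrite subr_ge0.
have [w ws wub] : exists2 w, (forall n, v n <= w) &
    forall e, 0 < e -> exists n, w - e < v n.
  have hs : has_sup [set v n | n in [set: nat]].
    by split; [exists (v 0), 0|exists 1 => _ [n _ <-]; have /andP[] := v01 n].
  exists (sup [set v n | n in [set: nat]]).
    by move=> n; apply: sup_upper_bound => //; exists n.
  by move=> e e0; have [_ [n _ <-] ?] := sup_adherent e0 hs; exists n.
have cau e : 0 < e -> exists N, forall n, (N <= n)%N -> nrm (u n - u N) <= e.
  move=> /wub[N wN]; exists N => n /subnKC <-; apply: le_trans (duvk _ _) _.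
  by have := ws (N + (n - N))%N; lra.
have [|y yl] := nrm_complete u.
  move=> e e0; have [N HN] := cau (e / 2) ltac:(by rewrite divr_gt0).
  exists N => m n Nm Nn; rewrite -(subrKA (u N)).
  apply: le_trans (nrmD _ _) _; rewrite [nrm (u N - _)]nrmBC.
  by have := HN _ Nm; have := HN _ Nn; lra.
have {}yl e : 0 < e -> exists n, nrm (u n - y) <= e /\ nrm (u n.+1 - y) <= e.
  by move=> /yl[N HN]; exists N; split; apply: HN.
have u1 n : nrm (u n) <= 1 by apply: le_trans (uv n) _; have /andP[] := v01 n.
have y1 : nrm y <= 1.
  apply/ler_addgt0Pl => e /yl[n [un _]]; rewrite -(subrK (u n) y).
  by apply: le_trans (nrmD _ _) _; rewrite nrmBC lerD.
have usa n : sa x -> sa (u n).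
  move=> sx; elim: n => [|n IH]; first exact: star0.
  by apply: saZ; apply: saD => //; exact: sa_sqr.
have ucomm n z : z * x = x * z -> z * u n = u n * z.
  move=> zx; elim: n => [|n IH]; first by rewrite mulr0 mul0r.
  by rewrite /= -scalerAr -scalerAl mulrDr mulrDl zx mulrA IH -mulrA IH mulrA.
have fixy : y = (2^-1)%:C *: (x + y * y).
  apply/eqP; rewrite -subr_eq0; apply/eqP; apply: (nrm_small (K := 2)) => e /yl[n [un un1]].
  have -> : y - (2^-1)%:C *: (x + y * y) = (y - u n.+1)
      + (2^-1)%:C *: ((u n - y) * u n + y * (u n - y)).
    have -> : (u n - y) * u n + y * (u n - y) = (x + u n * u n) - (x + y * y).
      by Ncring_tac.non_commutative_ring.
    by rewrite scalerBr addrA subrK.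
  apply: le_trans (nrmD _ _) _; rewrite nrmBC nrmZr ger0_norm ?invr_ge0//.
  have : nrm ((u n - y) * u n + y * (u n - y)) <= e * 1 + 1 * e.
    by apply: le_trans (nrmD _ _) _; apply: lerD; apply: nrmM_le.
  by lra.
exists y; split => // [|sx|z zx].
- have e2 : y + y = x + y * y.
    by rewrite {1 2}fixy -scalerDr -half_split.
  have -> : (1 - y) * (1 - y) = 1 - (y + y) + y * y by Ncring_tac.non_commutative_ring.
  by rewrite e2; Ncring_tac.non_commutative_ring.
- apply/eqP; rewrite -subr_eq0; apply/eqP; apply: (nrm_small (K := 2)) => e /yl[n [un _]].
  rewrite -(subrKA (u n)) -{1}(usa n sx) -starB.
  by apply: le_trans (nrmD _ _) _; rewrite nrm_star nrmBC; lra.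
- apply/eqP; rewrite -subr_eq0; apply/eqP.
  apply: (nrm_small (K := 2 * nrm z)) => e /yl[n [un _]].
  have -> : z * y - y * z = z * (y - u n) + (u n - y) * z.
    by rewrite mulrBr mulrBl ucomm// addrA subrK.
  apply: le_trans (nrmD _ _) _.
  have -> : 2 * nrm z * e = nrm z * e + e * nrm z by ring.
  by apply: lerD; apply: nrmM_le => //; rewrite nrmBC.
Qed.

Lemma conjc_im : conjc 'i%C = - 'i%C :> R[i].
Proof. by apply/eqP; rewrite eq_complex /= oppr0 !eqxx. Qed.

Lemma im_sqr : 'i%C * 'i%C = -1 :> R[i].
Proof. by rewrite -expr2 sqr_i. Qed.

(** For commuting self-adjoint [a] and [b], [a ^ 2 + b ^ 2] is [star u * u]
    with [u = a + i b], and [a] is the real part of [u]. *)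
Lemma nrm_sqr_le_sqrD (a b : B) : sa a -> sa b -> a * b = b * a ->
  nrm (a * a) <= nrm (a * a + b * b).
Proof.
move=> saa sab ab; pose u := a + 'i%C *: b.
have su : star u = a - 'i%C *: b.
  by rewrite starD starZ saa sab conjc_im scaleNr.
have uu : star u * u = a * a + b * b.
  rewrite su mulrDr !mulrBl -!scalerAl -!scalerAr ab scalerA im_sqr.
  by rewrite scaleN1r opprK addrA subrK.
rewrite -uu nrm_starM nrm_sa_sqr// ler_sqr ?nnegrE ?nrm_ge0//.
have -> : a = (2^-1)%:C *: (u + star u).
  by rewrite su [u + _]addrACA subrr addr0 -half_split.
rewrite nrmZr ger0_norm ?invr_ge0//; have := nrmD u (star u); rewrite nrm_star.
by lra.
Qed.

End unital_cstar.

Section positive_cone.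
Context {R : realType} {B : unitalCStarType R}.
Implicit Types (x y z h k : B) (s t : R).

Definition pos h := exists2 r, sa r & h = r * r.

Lemma pos_sa h : pos h -> sa h.
Proof. by move=> [r sr ->]; exact: sa_sqr. Qed.

Lemma sqr_sqrtZ t x : 0 <= t ->
  ((Num.sqrt t)%:C *: x) * ((Num.sqrt t)%:C *: x) = t%:C *: (x * x).
Proof.
by move=> t0; rewrite -scalerAl -scalerAr scalerM -[_ * _ in X in X *: _]expr2 sqr_sqrtr.
Qed.

Lemma posZ t h : 0 <= t -> pos h -> pos (t%:C *: h).
Proof.
move=> t0 [r sr ->]; exists ((Num.sqrt t)%:C *: r); first exact: saZ.
by rewrite sqr_sqrtZ.
Qed.

Lemma pos0 : pos 0.
Proof. by exists 0; [exact: star0|rewrite mulr0]. Qed.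

Lemma pos_one_minus x : sa x -> nrm x <= 1 -> pos (1 - x).
Proof.
move=> sx x1; have [y [<- _ sy _]] := sqrt_one_minus x1.
by exists (1 - y) => //; apply: saB; [exact: sa1|exact: sy].
Qed.

(** A self-adjoint [h] with [nrm h <= 1] is a square if and only if
    [nrm (1 - h) <= 1]; the second condition is convex, which is why the
    squares form a convex cone. *)
Lemma nrm_one_minus h : pos h -> nrm h <= 1 -> nrm (1 - h) <= 1.
Proof.
move=> [r sr ->] h1; have [y [yE _ sy yc]] := sqrt_one_minus h1.
have {}sy : sa (1 - y) by apply: saB; [exact: sa1|exact/sy/sa_sqr].
rewrite -yE; apply: le_trans (_ : nrm ((1 - y) * (1 - y) + r * r) <= 1).
  apply: nrm_sqr_le_sqrD => //.
  by rewrite mulrBr mulrBl mulr1 mul1r yc// mulrA.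
by rewrite yE subrK nrm1.
Qed.

Lemma pos_rescale h t : 0 < t -> pos h -> nrm h <= t ->
  pos (t^-1%:C *: h) /\ nrm (t^-1%:C *: h) <= 1.
Proof.
move=> t0 ph ht; have ti : 0 <= t^-1 by rewrite invr_ge0 ltW.
by split; [exact: posZ|rewrite nrmZr ger0_norm// ler_pdivrMl// mulr1].
Qed.

Lemma scalerK t x : t != 0 -> t%:C *: (t^-1%:C *: x) = x.
Proof. by move=> t0; rewrite scalerM mulfV// rmorph1 scale1r. Qed.

Lemma nrm_scale_minus h t : 0 < t -> pos h -> nrm h <= t ->
  nrm (t%:C%:A - h) <= t.
Proof.
move=> t0 ph ht; have [ph' h1] := pos_rescale t0 ph ht.
rewrite -[h](@scalerK t) ?gt_eqF// -scalerBr nrmZr gtr0_norm//.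
by rewrite -[leRHS]mulr1 (ler_wpM2l (ltW t0))//; exact: nrm_one_minus.
Qed.

Lemma pos_scale_minus x t : 0 < t -> sa x -> nrm x <= t -> pos (t%:C%:A - x).
Proof.
move=> t0 sx xt; rewrite -[x](@scalerK t) ?gt_eqF// -scalerBr.
apply: posZ (ltW t0) _; apply: pos_one_minus; first exact: saZ.
by rewrite nrmZr ger0_norm ?invr_ge0 ?(ltW t0)// ler_pdivrMl// mulr1.
Qed.

Lemma posD h k : pos h -> pos k -> pos (h + k).
Proof.
move=> ph pk; pose t := nrm h + nrm k + 1.
have t0 : 0 < t by rewrite ltr_wpDl// addr_ge0 ?nrm_ge0.
have ht : nrm h <= t by have := nrm_ge0 k; rewrite /t; lra.
have kt : nrm k <= t by have := nrm_ge0 h; rewrite /t; lra.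
have sx : sa (t%:C%:A - h + (t%:C%:A - k)).
  by apply: saD; apply: saB; try exact: pos_sa; apply: saZ; exact: sa1.
have : pos ((t + t)%:C%:A - (t%:C%:A - h + (t%:C%:A - k))).
  apply: pos_scale_minus => //; first exact: addr_gt0.
  by apply: le_trans (nrmD _ _) _; apply: lerD; exact: nrm_scale_minus.
congr pos; rewrite rmorphD scalerDl; by Ncring_tac.non_commutative_ring.
Qed.

Lemma pos_sum I (r : seq I) (F : I -> B) :
  (forall i, pos (F i)) -> pos (\sum_(i <- r) F i).
Proof. by move=> pF; elim/big_ind : _ => //; [exact: pos0|exact: posD]. Qed.

(** The square root of [1 - h] commutes with that of [h], so that the
    commutative inequality [nrm_sqr_le_sqrD] applies. *)
Lemma nrm_le1 h : pos h -> pos (1 - h) -> nrm h <= 1.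
Proof.
move=> [r sr ->] pk; pose t := nrm (1 - r * r) + 1.
have t0 : 0 < t by rewrite ltr_wpDl ?nrm_ge0.
have kt : nrm (1 - r * r) <= t by rewrite lerDl ler01.
have [pk' k1] := pos_rescale t0 pk kt.
have sk : sa (1 - t^-1%:C *: (1 - r * r)).
  by apply: saB; [exact: sa1|exact: pos_sa].
have [y [yE _ sy yc]] := sqrt_one_minus (nrm_one_minus pk' k1).
have ry : r * y = y * r.
  by apply: yc; rewrite mulrBr mulrBl mulr1 mul1r -scalerAr -scalerAl mulrBr mulrBl mulr1 mul1r mulrA.
pose w := (Num.sqrt t)%:C *: (1 - y).
have ww : w * w = 1 - r * r.
  rewrite sqr_sqrtZ ?(ltW t0)// yE subKr.
  by rewrite scalerK// gt_eqF.
have := nrm_sqr_le_sqrD sr (_ : sa w) (_ : r * w = w * r).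
rewrite ww addrC subrK nrm1; apply.
  by apply: saZ; apply: saB; [exact: sa1|exact: sy].
by rewrite -scalerAr -scalerAl mulrBr mulrBl mulr1 mul1r ry.
Qed.

Lemma nrm_le_scale h t : 0 < t -> pos h -> pos (t%:C%:A - h) -> nrm h <= t.
Proof.
move=> t0 ph pk; rewrite -[h](@scalerK t) ?gt_eqF//.
have t1 : 0 <= t^-1 by rewrite invr_ge0 ltW.
rewrite nrmZr gtr0_norm// -[leRHS]mulr1 (ler_wpM2l (ltW t0))//.
apply: nrm_le1; first exact: posZ.
have := posZ t1 pk; rewrite scalerBr scalerM mulVf ?gt_eqF//.
by rewrite rmorph1 scale1r.
Qed.

(** [k - h] and [t - k] are positive for every [t > nrm k], hence so is [t - h]. *)
Lemma nrm_mono h k : pos h -> pos (k - h) -> nrm h <= nrm k.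
Proof.
move=> ph pkh; apply/ler_addgt0Pl => e e0.
have t0 : 0 < e + nrm k by rewrite ltr_pwDl ?nrm_ge0.
apply: (nrm_le_scale t0) => //.
rewrite -[X in pos X](subrKA k); apply: posD => //.
apply: pos_scale_minus => //; last by rewrite lerDr ltW.
by rewrite -[k](subrK h); apply: saD; exact: pos_sa.
Qed.

(** The root is a limit of polynomials in [h], hence it commutes with whatever
    commutes with [h]. *)
Lemma pos_sqrt h : pos h -> exists k,
  [/\ pos k, k * k = h & forall z, z * h = h * z -> z * k = k * z].
Proof.
move=> ph; pose t := nrm h + 1.
have t0 : 0 < t by rewrite ltr_wpDl ?nrm_ge0.
have ht : nrm h <= t by rewrite lerDl ler01.
have [ph' h1] := pos_rescale t0 ph ht.
have [y [yE y1 sy yc]] := sqrt_one_minus (nrm_one_minus ph' h1).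
have {}sy : sa y by apply: sy; apply: saB; [exact: sa1|exact: pos_sa].
exists ((Num.sqrt t)%:C *: (1 - y)); split.
- by apply: posZ; [exact: sqrtr_ge0|exact: pos_one_minus].
- rewrite sqr_sqrtZ ?(ltW t0)// yE subKr.
  by rewrite scalerK// gt_eqF.
- move=> z zh; rewrite -scalerAr -scalerAl mulrBr mulrBl mulr1 mul1r yc//.
  by rewrite mulrBr mulrBl mulr1 mul1r -scalerAr -scalerAl zh.
Qed.

Lemma pos_comm_mul h k : pos h -> pos k -> h * k = k * h -> pos (h * k).
Proof.
move=> ph pk hk; have [r [pr rr rc]] := pos_sqrt ph.
have [s [ps ss sc]] := pos_sqrt pk.
have rs : r * s = s * r by apply: sc; symmetry; apply: rc; rewrite hk.
exists (r * s); first by rewrite /sa starM (pos_sa pr) (pos_sa ps).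
have -> : r * s * (r * s) = r * (s * r) * s by Ncring_tac.non_commutative_ring.
by rewrite -rs -rr -ss; Ncring_tac.non_commutative_ring.
Qed.

Lemma cartesian x : exists a b,
  [/\ sa a, sa b, x = a + 'i%C *: b, star x = a - 'i%C *: b &
      star x * x + x * star x = (a * a + a * a) + (b * b + b * b)].
Proof.
pose a := (2^-1)%:C *: (x + star x).
pose b := - 'i%C *: ((2^-1)%:C *: (x - star x)).
have saa : sa a by apply: saZ; rewrite /sa starD starK addrC.
have sab : sa b.
  have cN : conjc (- 'i%C) = 'i%C :> R[i].
    by apply/eqP; rewrite eq_complex /= oppr0 opprK !eqxx.
  rewrite /sa starZ cN starZr starB starK.
  by rewrite /b scaleNr -scalerN -scalerN opprB.
have ib : 'i%C *: b = (2^-1)%:C *: (x - star x).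
  by rewrite scalerA mulrN im_sqr opprK scale1r.
have xE : x = a + 'i%C *: b.
  rewrite ib -scalerDr addrACA subrr addr0; exact: half_split.
have sxE : star x = a - 'i%C *: b.
  rewrite ib -scalerBr [RHS](_ : _ = (2^-1)%:C *: (star x + star x)).
    exact: half_split.
  by congr (_ *: _); Ncring_tac.non_commutative_ring.
exists a, b; split => //; rewrite sxE {1 2}xE.
have imM (d : B) : d * d = - (('i%C *: d) * ('i%C *: d)).
  by rewrite -scalerAl -scalerAr scalerA im_sqr scaleN1r opprK.
rewrite (imM b).
by Ncring_tac.non_commutative_ring.
Qed.

Lemma pos_symm x : pos (star x * x + x * star x).
Proof.
have [a [b [saa sab _ _ ->]]] := cartesian x.
by do !apply: posD; [exists a|exists a|exists b|exists b].
Qed.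

(** If [star y * y = - p], then [y * star y], being the sum of [p] and of
    [star y * y + y * star y], is positive, and its norm is [t = nrm p].  Hence
    [nrm (t p + p ^ 2) = nrm (star y * (t - y * star y) * y) <= t ^ 2], whereas
    [2 p ^ 2 <= t p + p ^ 2]. *)
Lemma starM_neg_eq0 y p : pos p -> star y * y = - p -> p = 0.
Proof.
move=> pp yp; pose t := nrm p.
have ty : nrm y ^+ 2 = t by rewrite -nrm_starM yp nrmN.
have [t0|t0] := eqVneq t 0; first exact: nrm_eq0.
have {}t0 : 0 < t by rewrite lt_neqAle eq_sym t0 nrm_ge0.
have py : pos (y * star y).
  rewrite -[y * star y](addrK (star y * y)) [X in pos (X - _)]addrC yp opprK.
  by apply: posD => //; rewrite -yp; exact: pos_symm.
have ny : nrm (y * star y) = t by rewrite nrm_Mstar.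
have le1 : nrm (t%:C *: p + p * p) <= t * t.
  have -> : t%:C *: p + p * p = - (star y * ((t%:C%:A - y * star y) * y)).
    rewrite mulrBl mulrBr -scalerAl mul1r -scalerAr yp.
    have -> : star y * (y * star y * y) = (star y * y) * (star y * y).
      by Ncring_tac.non_commutative_ring.
    by rewrite yp scalerN mulrNN opprB opprK addrC.
  rewrite nrmN; apply: le_trans (nrmM _ _) _.
  apply: le_trans (_ : nrm (star y) * (t * nrm y) <= _).
    by apply: ler_wpM2l; [exact: nrm_ge0|apply: nrmM_le => //; apply: nrm_scale_minus => //; rewrite ny].
  by rewrite nrm_star mulrCA -expr2 ty.
have ptp : pos (t%:C *: p - p * p).
  have -> : t%:C *: p - p * p = p * (t%:C%:A - p).
    by rewrite mulrBr -scalerAr mulr1.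
  apply: pos_comm_mul => //; first by apply: pos_scale_minus => //; exact: pos_sa.
  by rewrite mulrBr mulrBl -scalerAr -scalerAl mulr1 mul1r.
have : nrm (p * p + p * p) <= t * t.
  apply: le_trans le1; apply: nrm_mono.
    by apply: posD; exists p => //; exact: pos_sa.
  by rewrite opprD addrA addrK.
have -> : p * p + p * p = 2%:C *: (p * p).
  by rewrite -[in RHS](mulr1n 2) -natr1 rmorphD/= rmorph1 scalerDl scale1r.
rewrite nrmZr ger0_norm// (nrm_sa_sqr (pos_sa pp)) -/t expr2 => tt.
exfalso; move: t0 tt; rewrite -/t; nra.
Qed.

(** With [h = star x * x], [k] the positive square root of [h ^ 2] and
    [w = k - h], the element [x * w] satisfies [starM_neg_eq0] for
    [p = k * w ^ 2].  So [k * w ^ 2 = 0], which forces [w = 0]. *)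
Lemma pos_starM x : pos (star x * x).
Proof.
set h := star x * x; have sh : sa h by rewrite /sa starM starK.
have [|k [pk kk kc]] := @pos_sqrt (h * h); first by exists h.
have hk : h * k = k * h by apply: kc; rewrite mulrA.
pose w := k - h; have sw : sa w by apply: saB; [exact: pos_sa|].
have wk : w * k = k * w by rewrite mulrBl mulrBr hk.
have kww : pos (k * (w * w)).
  apply: pos_comm_mul => //; first by exists w.
  by rewrite mulrA -wk -!mulrA wk.
have hw : h * w = - (k * w) by rewrite /w !mulrBr hk kk opprB.
have p0 : k * (w * w) = 0.
  apply: (@starM_neg_eq0 (x * w)) => //.
  have -> : star (x * w) * (x * w) = w * (h * w).
    by rewrite starM sw /h; Ncring_tac.non_commutative_ring.
  by rewrite hw mulrN [w * (k * w)]mulrA wk -mulrA.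
have hhw : h * h * w = 0.
  have : k * (w * w) = (h * h * w) + (h * h * w).
    have -> : k * (w * w) = (k * k * k - k * (k * h)) - (k * h * k - k * (h * h)).
      by rewrite /w; Ncring_tac.non_commutative_ring.
    have -> : k * h * k = k * k * h by rewrite -mulrA hk mulrA.
    rewrite -kk /w; by Ncring_tac.non_commutative_ring.
  rewrite p0 => e; rewrite [LHS]half_split -e.
  exact: scaler0.
have ww : w * w = - (h * w) - (h * w).
  rewrite {1}/w mulrBl hw; by rewrite opprK.
have w4 : (w * w) * (w * w) = 0.
  have wh : w * h = h * w by rewrite /w mulrBl mulrBr hk.
  rewrite ww.
  have -> : (- (h * w) - h * w) * (- (h * w) - h * w) =
     h * (w * h) * w + h * (w * h) * w + h * (w * h) * w + h * (w * h) * w.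
    by Ncring_tac.non_commutative_ring.
  by rewrite wh (mulrA h h) hhw mul0r !addr0.
have w0 : w = 0.
  have := congr1 nrm w4; rewrite nrm_sa_sqr ?nrm_sa_sqr ?nrm0; last 2 first.
  - exact: sw.
  - exact: sa_sqr.
  by move/eqP; rewrite !expf_eq0/= => /eqP/nrm_eq0.
by have /eqP := w0; rewrite subr_eq0 => /eqP <-.
Qed.

Lemma pos_Mstar x : pos (x * star x).
Proof. by rewrite -{1}(starK x); exact: pos_starM. Qed.

Lemma pos_conj x h : pos h -> pos (star x * h * x).
Proof.
move=> [r sr ->]; have -> : star x * (r * r) * x = star (r * x) * (r * x).
  by rewrite starM sr; Ncring_tac.non_commutative_ring.
exact: pos_starM.
Qed.

Lemma nrm_le1_starM x : pos (1 - star x * x) -> nrm x <= 1.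
Proof.
move=> px; apply: nrm_sqr_le; rewrite ?ler01// expr1n.
by apply: nrm_le1 => //; exact: pos_starM.
Qed.

Lemma pos_one_minus_starM x : nrm x <= 1 -> pos (1 - star x * x).
Proof.
move=> x1; apply: pos_one_minus; first by rewrite /sa starM starK.
by rewrite nrm_starM; apply: exprn_ile1 => //; exact: nrm_ge0.
Qed.

(** [s * y * s + b * x * b] is the product of the row [(s, b)], the diagonal
    matrix with entries [y] and [x], and the column with entries [s] and [b].
    If [c] denotes that column, [1 - c * star c] is positive, which yields the
    two squares below. *)
Lemma nrm_sandwich (s b : B) x y : sa s -> sa b -> pos (1 - (s * s + b * b)) ->
  nrm x <= 1 -> nrm y <= 1 -> nrm (s * y * s + b * x * b) <= 1.
Proof.
move=> ss sb psb x1 y1; set w := s * y * s + b * x * b.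
apply: nrm_le1_starM.
have sw : star w = s * star y * s + b * star x * b.
  by rewrite /w starD !starM ss sb !mulrA.
pose u := y * s - s * w; pose v := x * b - b * w.
have -> : 1 - star w * w = star s * (1 - star y * y) * s
    + star b * (1 - star x * x) * b + (star u * u + star v * v)
    + (star w * (1 - (s * s + b * b)) * w + (1 - (s * s + b * b))).
  rewrite /u /v !starB !starM ss sb sw /w; by Ncring_tac.non_commutative_ring.
apply: posD; first (apply: posD; apply: posD).
- by apply: pos_conj; exact: pos_one_minus_starM.
- by apply: pos_conj; exact: pos_one_minus_starM.
- exact: pos_starM.
- exact: pos_starM.
by apply: posD => //; exact: pos_conj.
Qed.

End positive_cone.

(** * Cutoffs and positive functionals *)

Section cutoff.
Context {R : realType} {B : unitalCStarType R}.
Implicit Types (x y z h k c : B).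

Lemma star_exp h n : sa h -> sa (h ^+ n).
Proof.
move=> sh; elim: n => [|n IH]; first by rewrite expr0; exact: sa1.
by rewrite exprS /sa starM IH sh -exprSr exprS.
Qed.

Lemma pos_exp h n : pos h -> pos (h ^+ n).
Proof.
by move=> [r sr ->]; exists (r ^+ n); [exact: star_exp|rewrite exprMn_comm].
Qed.

Lemma posMn h n : pos h -> pos (h *+ n).
Proof. by move=> ph; elim: n => [|n IH]; [exact: pos0|rewrite mulrS; exact: posD]. Qed.

Lemma nrmMn x n : nrm (x *+ n) = n%:R * nrm x.
Proof.
rewrite -scaler_nat -(rmorph_nat (real_complex R)) nrmZr.
by rewrite ger0_norm// ler0n.
Qed.

Section powers.
Variables (c : B) (pc : pos c) (pu : pos (1 - c)).
Let u := 1 - c.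

Let cu n : c * u ^+ n = u ^+ n * c.
Proof. by apply: commrX; rewrite /GRing.comm /u mulrBr mulrBl mulr1 mul1r. Qed.

Lemma pos_mul_exp n : pos (c * u ^+ n).
Proof. by apply: pos_comm_mul; rewrite ?cu//; exact: pos_exp. Qed.

Lemma one_minus_expS n : 1 - u ^+ n.+1 = (1 - u ^+ n) + c * u ^+ n.
Proof. by rewrite exprS /u mulrBl mul1r; Ncring_tac.non_commutative_ring. Qed.

Lemma pos_one_minus_exp n : pos (1 - u ^+ n).
Proof.
elim: n => [|n IH]; first by rewrite expr0 subrr; exact: pos0.
by rewrite one_minus_expS; apply: posD => //; exact: pos_mul_exp.
Qed.

Lemma pos_bernoulli n : pos (c *+ n - (1 - u ^+ n)).
Proof.
elim: n => [|n IH]; first by rewrite expr0 mulr0n subrr subr0; exact: pos0.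
have -> : c *+ n.+1 - (1 - u ^+ n.+1) = (c *+ n - (1 - u ^+ n)) + c * (1 - u ^+ n).
  by rewrite mulrSr one_minus_expS; Ncring_tac.non_commutative_ring.
apply: posD => //; apply: pos_comm_mul => //; first exact: pos_one_minus_exp.
by rewrite mulrBr mulrBl mulr1 mul1r cu.
Qed.

(** The function [t (1 - t) ^ n] is at most [1 / n] on the unit interval. *)
Lemma nrm_mul_exp n : nrm ((c * u ^+ n) *+ n) <= 1.
Proof.
apply: nrm_le1; first by apply: posMn; exact: pos_mul_exp.
rewrite -[X in pos X](subrK (u ^+ n)); apply: posD; last exact: pos_exp.
elim: n => [|n IH]; first by rewrite mulr0n subr0 expr0 subrr; exact: pos0.
have -> : 1 - (c * u ^+ n.+1) *+ n.+1 - u ^+ n.+1 =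
    (1 - (c * u ^+ n) *+ n - u ^+ n) + (c * u ^+ n * c) *+ n.+1.
  have -> : (c * u ^+ n.+1) *+ n.+1 = (c * u ^+ n) *+ n + c * u ^+ n
      - (c * u ^+ n * c) *+ n.+1.
    have -> : c * u ^+ n.+1 = c * u ^+ n - c * u ^+ n * c.
      by rewrite exprSr mulrA {2}/u mulrBr mulr1.
    by rewrite mulrnBl mulrSr.
  by rewrite exprS {3}/u mulrBl mul1r; Ncring_tac.non_commutative_ring.
apply: posD => //; apply: posMn.
have <- : star c * u ^+ n * c = c * u ^+ n * c by rewrite (pos_sa pc).
by apply: pos_conj; exact: pos_exp.
Qed.

End powers.

(** With [c = (star x * x + x * star x) / 2] and [s = (1 - c) ^ m], take
    [b = 1 - s]: where [c] is much smaller than [1 / m], [b] is small, and where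
    [c] is much larger, [s] is small, so that [b * x * b] is close to [x]. *)
Lemma cutoff m x : (0 < m)%N -> nrm x <= 1 -> exists b,
  [/\ sa b, nrm b <= 1, pos (1 - ((1 - b) * (1 - b) + b * b)),
      pos ((star x * x + x * star x) *+ m - b * b) &
      nrm (x - b * x * b) <= 3 / Num.sqrt m%:R].
Proof.
move=> m0 x1; pose a := star x * x + x * star x.
pose c := (2^-1)%:C *: a; have pa : pos a := pos_symm x.
have pc : pos c by apply: posZ; rewrite ?invr_ge0.
have ac : a = c + c by rewrite /c -scalerDr -half_split.
have c1 : nrm c <= 1.
  rewrite nrmZr ger0_norm ?invr_ge0//.
  have := nrmD (star x * x) (x * star x); rewrite nrm_starM nrm_Mstar -/a.
  have : nrm x ^+ 2 <= 1 by apply: exprn_ile1 => //; exact: nrm_ge0.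
  lra.
have pu : pos (1 - c) by apply: pos_one_minus => //; exact: pos_sa.
pose s := (1 - c) ^+ m; pose b := 1 - s.
have ps : pos s := pos_exp m pu.
have pb : pos b := pos_one_minus_exp pc pu m.
have psb : pos (s * b).
  by apply: pos_comm_mul => //; rewrite mulrBr mulrBl mulr1 mul1r.
have sE : s = 1 - b by rewrite subKr.
have b1 : nrm b <= 1 by apply: nrm_le1 => //; rewrite -sE.
have s1 : nrm s <= 1 by apply: nrm_le1.
pose e : R := (Num.sqrt m%:R)^-1.
have e0 : 0 <= e by rewrite invr_ge0 sqrtr_ge0.
have key y : pos (a - star y * y) -> nrm (y * s) <= e.
  move=> py; apply: nrm_sqr_le => //.
  rewrite exprVn sqr_sqrtr ?ler0n//.
  apply: le_trans (_ : nrm (c * (1 - c) ^+ (m + m) + c * (1 - c) ^+ (m + m)) <= _).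
    apply: nrm_mono; first exact: pos_starM.
    have -> : c * (1 - c) ^+ (m + m) + c * (1 - c) ^+ (m + m) = star s * a * s.
      rewrite (pos_sa ps) exprD -/s ac.
      have -> : c * (s * s) = s * c * s.
        rewrite mulrA; congr (_ * _); apply: commrX.
        by rewrite /GRing.comm mulrBr mulrBl mulr1 mul1r.
      by Ncring_tac.non_commutative_ring.
    have -> : star s * a * s - star (y * s) * (y * s) = star s * (a - star y * y) * s.
      by rewrite starM; Ncring_tac.non_commutative_ring.
    exact: pos_conj.
  have := nrm_mul_exp pc pu (m + m); rewrite nrmMn natrD => H.
  have m0' : 0 < m%:R :> R by rewrite ltr0n.
  apply: le_trans (nrmD _ _) _; rewrite -[leRHS]mul1r ler_pdivlMr//.
  by move: H; set N := nrm _; nra.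
have xs : nrm (x * s) <= e.
  by apply: key; rewrite /a addrAC subrr add0r; exact: pos_Mstar.
have sx : nrm (s * x) <= e.
  rewrite -nrm_star starM (pos_sa ps); apply: key.
  by rewrite starK /a addrK; exact: pos_starM.
exists b; split => //; first exact: pos_sa.
- have -> : 1 - ((1 - b) * (1 - b) + b * b) = s * b + s * b.
    by rewrite sE; Ncring_tac.non_commutative_ring.
  exact: posD.
- have -> : a *+ m - b * b = (c *+ m - b) + (c *+ m + s * b).
    by rewrite ac mulrnDl sE; Ncring_tac.non_commutative_ring.
  apply: posD; first exact: pos_bernoulli.
  by apply: posD => //; exact: posMn.
- have -> : x - b * x * b = s * x + x * s - s * (x * s).
    by rewrite sE; Ncring_tac.non_commutative_ring.
  have : nrm (s * (x * s)) <= 1 * e by apply: nrmM_le.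
  have := nrmB (s * x + x * s) (s * (x * s)); have := nrmD (s * x) (x * s).
  rewrite -/e; lra.
Qed.

End cutoff.

Section positive_functionals.
Context {R : realType} {B : unitalCStarType R}.
Implicit Types (x y z h k w : B) (phi g : B -> R).

Definition positive_functional phi :=
  [/\ real_linear phi, forall x, 0 <= phi (x * star x) &
      exists2 K, 0 <= K & forall x, phi x <= K * nrm x].

Lemma positive_functional_ge0 phi h : positive_functional phi -> pos h -> 0 <= phi h.
Proof. by move=> [_ p _] [r sr ->]; have := p r; rewrite sr. Qed.

Lemma positive_functional_mono phi h k : positive_functional phi -> pos (k - h) -> phi h <= phi k.
Proof.
by move=> pp /(positive_functional_ge0 pp); case: pp => lf _ _; rewrite real_linearB// subr_ge0.
Qed.

Lemma positive_functional0 : positive_functional (fun=> 0).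
Proof.
split=> //; first by split=> [x y|t x]; rewrite ?addr0 ?mulr0.
by exists 0 => // x; rewrite mul0r.
Qed.

Lemma positive_functionalD phi psi : positive_functional phi ->
  positive_functional psi -> positive_functional (fun x => phi x + psi x).
Proof.
move=> [lf pf [K K0 fK]] [lg pg [L L0 gL]]; split.
- split=> [x y|t x]; first by rewrite lf.1 lg.1 addrACA.
  by rewrite lf.2 lg.2 mulrDr.
- by move=> x; apply: addr_ge0.
- exists (K + L); first exact: addr_ge0.
  by move=> x; rewrite mulrDl lerD.
Qed.

Lemma star_sum I (r : seq I) (F : I -> B) :
  star (\sum_(i <- r) F i) = \sum_(i <- r) star (F i).
Proof. by apply: big_morph; [exact: starD|exact: star0]. Qed.

(** For [w = \sum g x *: x] and [r = \sum (g x) ^ 2 = g w], the sum of the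
    [v * star v] with [v = x - (g x / r) *: w] is [q - r^-1 *: (w * star w)]. *)
Lemma sum_sqr_le g M (l : seq B) : real_linear g -> 0 <= M ->
  (forall x, g x <= M * nrm x) ->
  \sum_(x <- l) g x ^+ 2 <= M ^+ 2 * nrm (\sum_(x <- l) x * star x).
Proof.
move=> lg M0 gM; set r := \sum_(x <- l) _; set q := \sum_(x <- l) x * _.
have r0 : 0 <= r by apply: sumr_ge0 => x _; exact: sqr_ge0.
have [->|rn0] := eqVneq r 0; first by rewrite mulr_ge0 ?exprn_ge0 ?nrm_ge0.
have {}r0 : 0 < r by rewrite lt_neqAle eq_sym rn0.
pose w := \sum_(x <- l) (g x)%:C *: x.
have gw : g w = r.
  rewrite real_linear_sum//; apply: eq_bigr => x _.
  by rewrite lg.2 expr2.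
pose v x := x - (r^-1 * g x)%:C *: w.
have pq : pos (q - r^-1%:C *: (w * star w)).
  have -> : q - r^-1%:C *: (w * star w) = \sum_(x <- l) v x * star (v x).
    rewrite (eq_bigr (fun x => x * star x
        + (- r^-1%:C *: (((g x)%:C *: x) * star w + w * star ((g x)%:C *: x))
        + (r^-1 * r^-1 * (g x ^+ 2))%:C *: (w * star w)))); last first.
      move=> x _; rewrite /v starB !starZr.
      have -> : (x - (r^-1 * g x)%:C *: w) * (star x - (r^-1 * g x)%:C *: star w)
        = x * star x + (- (x * ((r^-1 * g x)%:C *: star w)
            + ((r^-1 * g x)%:C *: w) * star x)
            + ((r^-1 * g x)%:C *: w) * ((r^-1 * g x)%:C *: star w)).
        by Ncring_tac.non_commutative_ring.
      congr (_ + (_ + _)).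
        by rewrite -!scalerAl -!scalerAr -!scalerDr scaleNr scalerM.
      by rewrite -scalerAl -scalerAr scalerM; congr (_%:C *: _); ring.
    rewrite big_split/= -/q; congr (_ + _).
    rewrite big_split/= -scaler_sumr big_split/= -mulr_suml -mulr_sumr.
    rewrite -star_sum -/w -scaler_suml -rmorph_sum -mulr_sumr -/r.
    have -> : r^-1 / r * r = r^-1 by rewrite divfK.
    by rewrite scaleNr scalerDr opprD subrK.
  by apply: pos_sum => x; exact: pos_Mstar.
have H : r^-1 * nrm w ^+ 2 <= nrm q.
  rewrite -nrm_Mstar -[X in X * _]ger0_norm ?invr_ge0 ?(ltW r0)// -nrmZr.
  apply: nrm_mono => //; apply: posZ (pos_Mstar w); by rewrite invr_ge0 ltW.
move: H; rewrite ler_pdivrMl// => H.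
have rw : r <= M * nrm w by rewrite -{1}gw; exact: gM.
have r2 : r * r <= M ^+ 2 * nrm w ^+ 2.
  by rewrite -exprMn -expr2 ler_sqr ?nnegrE ?mulr_ge0 ?nrm_ge0// ltW.
rewrite -(ler_pM2l r0); apply: le_trans r2 _.
by rewrite [leRHS]mulrCA; apply: ler_wpM2l H; exact: exprn_ge0.
Qed.

(** By [mazur_orlicz]: the wanted values [g w ^+ 2 <= phi (w * star w)] are
    compatible with a bound on [phi] exactly because of [sum_sqr_le].  They also
    make [phi] positive. *)
Lemma dominated_left g M : real_linear g -> 0 <= M ->
  (forall x, g x <= M * nrm x) ->
  exists phi, positive_functional phi /\ forall w, g w ^+ 2 <= phi (w * star w).
Proof.
move=> lg M0 gM.
pose C q r := exists l : seq B, q = \sum_(x <- l) x * star x /\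
  r = \sum_(x <- l) g x ^+ 2.
have [|||phi [lphi phiM Cphi]] := @mazur_orlicz _ _ (fun x => M ^+ 2 * nrm x) C.
- split=> [x y|t x t0]; first by rewrite -mulrDr ler_wpM2l ?exprn_ge0// nrmD.
  by rewrite nrmZr ger0_norm// mulrCA.
- split.
  + by exists [::]; rewrite !big_nil.
  + by move=> _ _ _ _ [l [-> ->]] [l' [-> ->]]; exists (l ++ l'); rewrite !big_cat.
  + move=> t _ _ t0 [l [-> ->]]; exists [seq (Num.sqrt t)%:C *: x | x <- l].
    rewrite !big_map scaler_sumr mulr_sumr; split; apply: eq_bigr => x _.
      by rewrite starZr -scalerAl -scalerAr scalerM -expr2 sqr_sqrtr.
    by rewrite lg.2 exprMn sqr_sqrtr.
- by move=> _ _ [l [-> ->]]; exact: sum_sqr_le.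
have gphi w : g w ^+ 2 <= phi (w * star w).
  by apply: Cphi; exists [:: w]; rewrite !big_seq1.
exists phi; split => //; split => //; last by exists (M ^+ 2); rewrite ?exprn_ge0.
by move=> x; apply: le_trans (gphi x); exact: sqr_ge0.
Qed.

Definition dominates phi g := forall w,
  g w ^+ 2 <= phi (w * star w) /\ g w ^+ 2 <= phi (star w * w).

(** [dominated_left], applied to [g] and to [g \o star], controls the two sides. *)
Lemma dominated g M : real_linear g -> 0 <= M -> (forall x, g x <= M * nrm x) ->
  exists phi, positive_functional phi /\ dominates phi g.
Proof.
move=> lg M0 gM; have [phi [pphi gphi]] := dominated_left lg M0 gM.
have [|x|psi [ppsi gpsi]] := @dominated_left (g \o star) M _ M0.
- by split=> [x y|t x] /=; rewrite ?starD ?starZr ?lg.1 ?lg.2.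
- by rewrite /= -nrm_star.
exists (fun x => phi x + psi x); split; first exact: positive_functionalD.
move=> w; split.
  apply: le_trans (gphi w) _; rewrite lerDl; case: ppsi => _ p _; exact: p.
have := gpsi (star w); rewrite /= starK => H; apply: le_trans H _.
by rewrite lerDr; case: pphi => _ p _; have := p (star w); rewrite starK.
Qed.

Lemma dominatesD phi psi g : positive_functional psi -> dominates phi g ->
  dominates (fun x => phi x + psi x) g.
Proof.
move=> ppsi dg w; have [d1 d2] := dg w; split.
  by apply: le_trans d1 _; rewrite lerDl; apply: positive_functional_ge0 => //; exact: pos_Mstar.
by apply: le_trans d2 _; rewrite lerDl; apply: positive_functional_ge0 => //; exact: pos_starM.
Qed.

(** If [nrm z <= 1], then [b * z * star (b * z)] and [star (z * b) * (z * b)] are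
    at most [b * b]. *)
Lemma dominated_small phi g b z e : positive_functional phi -> dominates phi g ->
  sa b -> nrm z <= 1 -> 0 <= e -> phi (b * b) <= e ^+ 2 ->
  `|g (b * z)| <= e /\ `|g (z * b)| <= e.
Proof.
move=> pphi dg sb z1 e0 be.
have sqr_le t : t ^+ 2 <= e ^+ 2 -> `|t| <= e.
  by rewrite -real_normK ?num_real// ler_sqr ?nnegrE.
split; apply: sqr_le.
  apply: le_trans (dg _).1 (le_trans _ be); apply: positive_functional_mono => //.
  have -> : b * b - b * z * star (b * z) = star b * (1 - star (star z) * star z) * b.
    by rewrite starM starK sb; Ncring_tac.non_commutative_ring.
  by apply: pos_conj; apply: pos_one_minus_starM; rewrite nrm_star.
apply: le_trans (dg _).2 (le_trans _ be); apply: positive_functional_mono => //.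
have -> : b * b - star (z * b) * (z * b) = star b * (1 - star z * z) * b.
  by rewrite starM sb; Ncring_tac.non_commutative_ring.
by apply: pos_conj; exact: pos_one_minus_starM.
Qed.

End positive_functionals.

(** * Separation and weak limits in normed spaces *)

Section normed_space.
Context {R : realType}.
Implicit Type E : normedModType R[i].

Definition rnorm E (x : E) : R := complex.Re `|x|.

Lemma rnormE E (x : E) : `|x| = (rnorm x)%:C.
Proof. by rewrite /rnorm RRe_real// normr_real. Qed.

Lemma rnorm_ge0 E (x : E) : 0 <= rnorm x.
Proof. by rewrite -lecR -rnormE normr_ge0. Qed.

Lemma rnormD E (x y : E) : rnorm (x + y) <= rnorm x + rnorm y.
Proof. by rewrite -lecR real_complexD -!rnormE ler_normD. Qed.

Lemma rnormZ E (a : R[i]) (x : E) : rnorm (a *: x) = complex.Re `|a| * rnorm x.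
Proof. by rewrite {1}/rnorm normrZ -{1}(RRe_real (normr_real a)) complex_ReM. Qed.

Lemma rnormZr E t (x : E) : rnorm (t%:C *: x) = `|t| * rnorm x.
Proof. by rewrite rnormZ normc_real. Qed.

Lemma rnorm0 E : rnorm (0 : E) = 0.
Proof. by rewrite /rnorm normr0. Qed.

Lemma rnormN E (x : E) : rnorm (- x) = rnorm x.
Proof. by rewrite /rnorm normrN. Qed.

Lemma rnormB E (x y : E) : rnorm (x - y) <= rnorm x + rnorm y.
Proof. by rewrite -(rnormN y); exact: rnormD. Qed.

Lemma rnorm_sublinear E : sublinear (@rnorm E).
Proof.
split; first exact: rnormD.
by move=> t x t0; rewrite rnormZr ger0_norm.
Qed.

Lemma real_linear_abs E (f : E -> R) K x : real_linear f ->
  (forall x, f x <= K * rnorm x) -> `|f x| <= K * rnorm x.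
Proof.
move=> lf fK; rewrite ler_norml fK andbT lerNl -real_linearN//.
by rewrite -(rnormN x); exact: fK.
Qed.

Lemma norming_functional E (x : E) :
  exists f : E -> R, [/\ real_linear f, forall y, f y <= rnorm y & f x = rnorm x].
Proof.
pose C (c : E) (r : R) := exists2 t, 0 <= t & c = t%:C *: x /\ r = t * rnorm x.
have [|_ _ [t t0 [-> ->]]|f [lf fle Cf]] := @mazur_orlicz _ _ _ C (@rnorm_sublinear E).
- split=> [|_ _ _ _ [t t0 [-> ->]] [s s0 [-> ->]]|t _ _ t0 [s s0 [-> ->]]].
  + by exists 0 => //; rewrite scale0r mul0r.
  + by exists (t + s); [exact: addr_ge0|rewrite rmorphD scalerDl mulrDl].
  + by exists (t * s); [exact: mulr_ge0|rewrite rmorphM scalerA mulrA].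
- by rewrite rnormZr ger0_norm.
exists f; split => //; apply/eqP; rewrite eq_le fle/=; apply: Cf.
by exists 1; rewrite ?ler01// scale1r mul1r.
Qed.

Definition convex_subset E (K : E -> Prop) := forall s t x y,
  0 <= s -> 0 <= t -> s + t = 1 -> K x -> K y -> K (s%:C *: x + t%:C *: y).

(** The constraints are [t * d <= f (t (p - k))] for [t >= 0] and [k] in [K];
    convexity of [K] is what makes them a cone. *)
Lemma separation E (K : E -> Prop) (p : E) d : convex_subset K -> (exists k, K k) ->
  (forall k, K k -> d <= rnorm (p - k)) ->
  exists f : E -> R, [/\ real_linear f, forall y, f y <= rnorm y &
    forall k, K k -> f k + d <= f p].
Proof.
move=> Kc [k0 Kk0] dK.
pose C (c : E) (r : R) := exists t k, [/\ 0 <= t, K k, c = t%:C *: (p - k) & r = t * d].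
have [||f [lf fle Cf]] := @mazur_orlicz _ _ _ C (@rnorm_sublinear E).
- split.
  + by exists 0, k0; split => //; rewrite ?scale0r ?mul0r.
  + move=> _ _ _ _ [s [k [s0 Kk -> ->]]] [t [l [t0 Kl -> ->]]].
    have [st|st] := eqVneq (s + t) 0.
      exists 0, k0; have {s0 t0 st} [-> ->] : s = 0 /\ t = 0 by lra.
      by split => //; rewrite ?scale0r ?mul0r !addr0.
    have st0 : 0 < s + t by rewrite lt_neqAle eq_sym st addr_ge0.
    exists (s + t), ((s / (s + t))%:C *: k + (t / (s + t))%:C *: l); split.
    * exact: addr_ge0.
    * apply: Kc => //; rewrite ?divr_ge0 ?addr_ge0// -mulrDl divff//.
    * rewrite [RHS]scalerBr [in RHS]scalerDr !scalerA -!rmorphM.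
      rewrite !(mulrC (s + t)) !divfK// rmorphD scalerDl !scalerBr opprD.
      by rewrite addrACA.
    * by rewrite mulrDl.
  + move=> t _ _ t0 [s [k [s0 Kk -> ->]]]; exists (t * s), k; split => //.
    * exact: mulr_ge0.
    * by rewrite scalerA -rmorphM.
    * by rewrite mulrA.
- by move=> _ _ [t [k [t0 Kk -> ->]]]; rewrite rnormZr ger0_norm// ler_wpM2l// dK.
exists f; split => // k Kk; rewrite -lerBrDl -real_linearB//; apply: Cf.
by exists 1, k; rewrite ler01 scale1r mul1r.
Qed.

(** Used as a stand-in for the linear span of [l]: bounding the coefficients
    separately makes it totally bounded without any estimate on the linear
    independence of [l]. *)
Fixpoint box E (l : seq E) (x : E) : Prop :=
  if l is v :: l' then
    exists t y, [/\ `|t| <= 1, box l' y & x = t%:C *: v + y]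
  else x = 0.

Lemma box_comb E (l : seq E) s t x y : `|s| + `|t| <= 1 -> box l x -> box l y ->
  box l (s%:C *: x + t%:C *: y).
Proof.
move=> st; elim: l x y => [|v l IH] x y /=; first by move=> -> ->; rewrite !scaler0 addr0.
move=> [a [x' [a1 bx ->]]] [b [y' [b1 by_ ->]]].
exists (s * a + t * b), (s%:C *: x' + t%:C *: y'); split.
- apply: le_trans (ler_normD _ _) _; rewrite !normrM.
  by have := normr_ge0 s; have := normr_ge0 t; nra.
- exact: IH.
- by rewrite !scalerDr addrACA !scalerA rmorphD !rmorphM scalerDl.
Qed.

Lemma box_convex E (l : seq E) : convex_subset (box l).
Proof.
by move=> s t x y s0 t0 st; apply: box_comb; rewrite !ger0_norm// st.
Qed.

Lemma box0 E (l : seq E) : box l 0.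
Proof.
elim: l => //= v l IH; exists 0, 0; split => //; rewrite ?normr0 ?ler01//.
by rewrite scale0r addr0.
Qed.

Lemma box_cons E (l : seq E) v x : box l x -> box (v :: l) x.
Proof. by move=> bx; exists 0, x; rewrite normr0 scale0r add0r ler01. Qed.

Lemma box_head E (l : seq E) v : box (v :: l) v.
Proof.
by exists 1, 0; split; [rewrite normr1|exact: box0|rewrite scale1r addr0].
Qed.

(** The coefficient of the head is rounded to a multiple of [1 / M]. *)
Lemma box_net E (l : seq E) e : 0 < e -> exists N : seq E,
  forall x, box l x -> exists2 y, y \in N & rnorm (x - y) <= e.
Proof.
elim: l e => [|v l IH] e e0.
  by exists [:: 0] => x /= ->; exists 0; rewrite ?inE// subrr rnorm0 ltW.
have [N HN] := IH (e / 2) ltac:(by rewrite divr_gt0).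
pose M := (Num.truncn (rnorm v * 2 / e)).+1.
have M0 : 0 < M%:R :> R by rewrite ltr0n.
have Mv : rnorm v / M%:R <= e / 2.
  rewrite ler_pdivrMr// mulrC -ler_pdivrMr ?divr_gt0// invf_div mulrA.
  by apply: ltW; exact: truncnS_gt.
exists [seq (j%:R / M%:R - 1)%:C *: v + y | j <- iota 0 (2 * M).+1, y <- N].
move=> _ [t [x [t1 bx ->]]]; have [y yN xy] := HN _ bx.
have /andP[tl tr] : -1 <= t <= 1 by rewrite -ler_norml.
pose j := Num.truncn ((t + 1) * M%:R).
have tM : 0 <= (t + 1) * M%:R by apply: mulr_ge0; [lra|exact: ltW].
have /andP[jl jr] := truncn_itv tM.
exists ((j%:R / M%:R - 1)%:C *: v + y).
  apply/allpairsP; exists (j, y); split => //.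
  rewrite mem_iota leq0n /fst andTb add0n ltnS -(ler_nat R) natrM.
  by apply: le_trans jl _; apply: ler_wpM2r; [exact: ltW|lra].
rewrite opprD addrACA -scalerBl -rmorphB.
apply: le_trans (rnormD _ _) _; rewrite rnormZr.
apply: le_trans (lerD (_ : _ <= e / 2) xy) _; last by lra.
apply: le_trans Mv; rewrite mulrC ler_wpM2l ?rnorm_ge0//.
have -> : t - (j%:R / M%:R - 1) = ((t + 1) * M%:R - j%:R) / M%:R.
  by field; rewrite gt_eqF.
rewrite normrM [`|_^-1|]gtr0_norm ?invr_gt0// -[leRHS]mul1r ler_pM2r ?invr_gt0//.
by rewrite ger0_norm ?subr_ge0// lerBlDl natr1 ltW.
Qed.

Lemma complexify_bounded E (f : E -> R) K : real_linear f -> 0 <= K ->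
  (forall x, f x <= K * rnorm x) -> bounded_map (complexify f : E -> R[i]^o).
Proof.
move=> lf K0 fK; exists (K + K) => x.
have -> : complexify f x = (f x)%:C + 'i%C * (- f ('i%C *: x))%:C.
  by rewrite /complexify; simpc.
apply: le_trans (ler_normD _ _) _; rewrite normrM !normc_def/= !expr0n/= !addr0.
rewrite !add0r expr1n sqrtr1 mul1r !sqrtr_sqr normrN -rmorphD rnormE -rmorphM lecR.
rewrite mulrDl; apply: lerD; first exact: real_linear_abs.
apply: le_trans (real_linear_abs _ lf fK) _.
by rewrite rnormZ normc_def/= expr0n expr1n add0r sqrtr1 mul1r.
Qed.

Lemma dual_le E (f : dual E) (x : E) : `|f x| <= `|f| * `|x|.
Proof.
have [->|x0] := eqVneq x 0; first by rewrite dual_fun0 !normr0 mulr0.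
have nx0 : 0 < rnorm x by rewrite -ltcR -rnormE normr_gt0.
pose y := (rnorm x)^-1%:C *: x.
have y1 : `|y| <= 1.
  by rewrite rnormE rnormZr gtr0_norm ?invr_gt0// mulVf ?gt_eqF.
have fy : f y = (rnorm x)^-1%:C * f x.
  by have := dual_linear f (rnorm x)^-1%:C x 0; rewrite !addr0 dual_fun0 addr0.
have := dual_norm_ub f y1; rewrite fy normrM.
rewrite -[`|_%:C|](RRe_real (normr_real _)) normc_real complex_ReM.
have ni0 : 0 < (rnorm x)^-1 by rewrite invr_gt0.
rewrite (gtr0_norm ni0) (ler_pdivrMl _ _ nx0) mulrC => H.
have -> : `|f| = (complex.Re (dual_norm f))%:C by [].
by rewrite rnormE -rmorphM -complex_Re_norm lecR.
Qed.

(** Bounded sequences of a reflexive space have a weak limit in the sense of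
    Banach limits: [mazur_orlicz] applied to the dual space provides a
    functional that exceeds every eventual lower bound of [f (s n)]. *)
Lemma reflexive_weak_limit E (s : nat -> E) K : reflexive_space E -> 0 <= K ->
  (forall n, rnorm (s n) <= K) ->
  exists y, forall (f : E -> R) (r : R), real_linear f -> (forall x, f x <= rnorm x) ->
    (exists n0, forall n, (n0 <= n)%N -> r <= f (s n)) -> r <= f y.
Proof.
move=> refl K0 sK.
pose C (F : dual E) r := exists n0, forall n, (n0 <= n)%N -> r <= complex.Re (F (s n)).
have ReZ (t : R) (F : dual E) x : complex.Re (dual_fun (t%:C *: F) x) = t * complex.Re (F x).
  exact: complex_ReM.
have [|||Phi [lPhi PhiK CPhi]] := @mazur_orlicz _ (dual E) (fun F => K * rnorm F) C.
- split=> [x y|t x t0]; first by rewrite -mulrDr ler_wpM2l// rnormD.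
  by rewrite rnormZr ger0_norm// mulrCA.
- split.
  + by exists 0%N => n _; have -> : dual_fun (0 : dual E) (s n) = 0.
  + move=> F r G q [n Hn] [m Hm]; exists (maxn n m) => k; rewrite geq_max => /andP[nk mk].
    have -> : complex.Re (dual_fun (F + G) (s k)) =
        complex.Re (dual_fun F (s k)) + complex.Re (dual_fun G (s k)).
      exact: complex_ReD.
    by apply: lerD; [exact: Hn|exact: Hm].
  + by move=> t F r t0 [n Hn]; exists n => k nk; rewrite ReZ ler_wpM2l// Hn.
- move=> F r [n Hn]; apply: le_trans (Hn n (leqnn n)) _.
  have Re_le (z : R[i]) : complex.Re z <= complex.Re `|z|.
    rewrite normc_def; case: z => a b /=; apply: le_trans (ler_norm a) _.
    by rewrite -sqrtr_sqr ler_wsqrtr// lerDl sqr_ge0.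
  apply: le_trans (Re_le _) _; rewrite -lecR complex_Re_norm.
  apply: le_trans (dual_le _ _) _; rewrite !rnormE -rmorphM lecR mulrC.
  by rewrite ler_wpM2r ?rnorm_ge0.
have Phi2 : complexify Phi \in @bounded_functional R (dual E).
  apply/asboolP; split; first exact: complexify_linear.
  exact: (complexify_bounded lPhi K0 PhiK).
have [y Hy] := refl (exist _ (complexify Phi) Phi2).
exists y => f r lf f1 Hr.
have f1' x : f x <= 1 * rnorm x by rewrite mul1r.
have ff : complexify f \in @bounded_functional R E.
  apply/asboolP; split; first exact: complexify_linear.
  exact: (complexify_bounded lf ler01 f1').
pose F : dual E := exist _ (complexify f) ff.
have /= := CPhi F r Hr.
by rewrite -[Phi F]/(complex.Re (complexify Phi F)) [complexify Phi F](Hy F).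
Qed.

End normed_space.

(** * Complemented reflexive subspaces *)

(** The symmetrised square of [x]; a positive functional applied to it is the
    square of a Hilbert seminorm of [x]. *)
Definition sqr_symm {R : realType} {B : unitalCStarType R} (x : B) :=
  star x * x + x * star x.

Section complemented_reflexive.
Context {R : realType} {B : unitalCStarType R} {E : normedModType R[i]}.
Variables (iota : {linear E -> B}) (P : {linear B -> E}) (M : R).
Hypothesis nrm_iota : forall x, nrm (iota x) = rnorm x.
Hypothesis rnorm_P : forall x, rnorm (P x) <= M * nrm x.
Hypothesis PK : forall x, P (iota x) = x.
Hypothesis M_gt0 : 0 < M.

Let functional (f : E -> R) := real_linear f /\ forall x, f x <= rnorm x.

Lemma functional_P f : functional f ->
  real_linear (f \o P) /\ forall x, (f \o P) x <= M * nrm x.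
Proof.
move=> [lf f1]; split; last by move=> x /=; apply: le_trans (f1 _) (rnorm_P x).
by split=> [x y|t x] /=; [rewrite linearD lf.1|rewrite linearZ lf.2].
Qed.

Lemma functional_dominated f : functional f ->
  exists phi, positive_functional phi /\ dominates phi (f \o P).
Proof. by move=> /functional_P[lf fM]; exact: dominated lf (ltW M_gt0) fM. Qed.

(** The functionals that dominate the norming functionals of the entries of [N]
    are added to [phi] one by one. *)
Lemma norming_dominated (N : seq E) phi : positive_functional phi ->
  exists psi, [/\ positive_functional psi,
    forall h, pos h -> phi h <= psi h &
    forall y, y \in N -> exists f, [/\ functional f, f y = rnorm y & dominates psi (f \o P)]].
Proof.
move=> pphi; elim: N => [|y N [psi [ppsi phipsi HN]]]; first by exists phi.
have [f [lf f1 fy]] := norming_functional y.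
have [chi [pchi dchi]] := functional_dominated (conj lf f1).
exists (fun x => psi x + chi x); split; first exact: positive_functionalD.
  move=> h ph; apply: le_trans (phipsi _ ph) _; rewrite lerDl; exact: positive_functional_ge0.
move=> z; rewrite inE => /predU1P[->|zN].
  exists f; split => // w; have [d1 d2] := dchi w; split.
    by apply: le_trans d1 _; rewrite lerDr; apply: positive_functional_ge0 => //; exact: pos_Mstar.
  by apply: le_trans d2 _; rewrite lerDr; apply: positive_functional_ge0 => //; exact: pos_starM.
have [g [fg gz dg]] := HN _ zN.
by exists g; split => //; exact: dominatesD.
Qed.

(** What fails when no [phi] satisfies the lower bound
    [e * rnorm x ^+ 2 <= phi (sqr_symm (iota x))]. *)
Hypothesis small : forall phi, positive_functional phi -> forall e, 0 < e ->
  exists x : E, rnorm x = 1 /\ phi (sqr_symm (iota x)) <= e.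

(** If [k] in the box were close to [x], it would have norm about 1, and so would
    the point [y] of the net that is close to [k]; but [x] is small for the
    functional that norms [y]. *)
Lemma small_far (l : seq E) phi e : positive_functional phi -> 0 < e ->
  exists x : E, [/\ rnorm x = 1, phi (sqr_symm (iota x)) <= e &
    forall k, box l k -> 4^-1 <= rnorm (x - k)].
Proof.
move=> pphi e0; have p8 : 0 < 8^-1 :> R by rewrite invr_gt0.
have [N HN] := box_net l p8.
have [psi [ppsi phipsi Npsi]] := norming_dominated N pphi.
have e'0 : 0 < Num.min e (8^-1 ^+ 2) by rewrite lt_min e0 exprn_gt0// invr_gt0.
have [x [x1]] := small ppsi e'0; rewrite le_min => /andP[xe x8].
exists x; split => //; first by apply: le_trans (phipsi _ _) xe; exact: pos_symm.
move=> k /HN[y /Npsi[f [[lf f1] fy df]] ky].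
have fx : f x <= 8^-1.
  have [d1 _] := df (iota x); rewrite /= PK in d1.
  rewrite leNgt; apply/negP => x8'.
  have : f x ^+ 2 <= 8^-1 ^+ 2.
    apply: le_trans d1 (le_trans _ x8); apply: positive_functional_mono => //.
    by rewrite /sqr_symm addrK; exact: pos_starM.
  rewrite leNgt => /negP; apply.
  rewrite ltr_pXn2r// nnegrE; apply: ltW => //; exact: lt_trans x8'.
have h1 : rnorm y <= rnorm (k - y) + rnorm (x - k) + f x.
  rewrite -fy [X in f X](_ : y = - (k - y) - (x - k) + x).
    2: by rewrite !opprB subrKA subrK.
  rewrite !lf.1; apply: lerD => //; apply: lerD.
    by apply: le_trans (f1 _) _; rewrite rnormN.
  by apply: le_trans (f1 _) _; rewrite rnormN.
have h2 : rnorm x <= rnorm (x - k) + rnorm (k - y) + rnorm y.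
  rewrite -{1}(subrK k x) -{2}(subrK y k) addrA.
  apply: le_trans (rnormD _ _) _; apply: lerD => //; exact: rnormD.
by move: h2; rewrite x1; lra.
Qed.

(* The exponent of the cutoff, large enough to make its error at most 1/16 after
   applying [P]. *)
Let m : nat := (Num.truncn ((48 * M) ^+ 2)).+1.

Let M_m : M * (3 / Num.sqrt m%:R) <= 16^-1.
Proof.
have m0 : 0 < Num.sqrt m%:R :> R by rewrite sqrtr_gt0 ltr0n.
have : 48 * M <= Num.sqrt m%:R.
  rewrite -[leLHS]ger0_norm ?mulr_ge0 ?(ltW M_gt0)// -sqrtr_sqr ler_wsqrtr//.
  by apply: ltW; exact: truncnS_gt.
by rewrite mulrA ler_pdivrMr//; lra.
Qed.

(** [cur] is the current term [Y] of the sequence, [ctl] a positive functional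
    that dominates the functionals chosen so far, and [past] lists the images
    under [P] of the terms constructed so far. *)
Record stage := Stage { cur : B; ctl : B -> R; past : seq E }.

Definition stage_ok s := nrm (cur s) <= 1 /\ positive_functional (ctl s).

Definition stage_next e s s' :=
  [/\ past s' = P (cur s') :: past s,
      forall g, real_linear g -> dominates (ctl s) g -> `|g (cur s') - g (cur s)| <= e,
      forall g, dominates (ctl s) g -> dominates (ctl s') g &
      exists f, [/\ functional f, dominates (ctl s') (f \o P) &
        forall k, box (past s) k -> f k + 8^-1 <= f (P (cur s'))]].

(** For one of the two signs, [P ((1 - b) * Y * (1 - b) +- b * x * b)] is far
    from the box of the past: the half-difference of the two values is close to
    [x]. *)
Lemma stage_nextP e s : 0 < e -> stage_ok s ->
  exists s', stage_ok s' /\ stage_next e s s'.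
Proof.
case: s => Y phi l e0 [/= Y1 pphi].
have m0 : 0 < m%:R :> R by rewrite ltr0n.
have em0 : 0 < (e / 4) ^+ 2 / m%:R by rewrite divr_gt0// exprn_gt0// divr_gt0.
have [x [x1 xe xfar]] := small_far l pphi em0.
have ix1 : nrm (iota x) <= 1 by rewrite nrm_iota x1.
have [b [sb b1 psb bm bx]] := cutoff (ltn0Sn _ : 0 < m)%N ix1.
pose Z z := (1 - b) * Y * (1 - b) + b * z * b.
have phib : phi (b * b) <= (e / 4) ^+ 2.
  apply: le_trans (positive_functional_mono pphi bm) _.
  have -> : phi ((star (iota x) * iota x + iota x * star (iota x)) *+ m)
      = phi (sqr_symm (iota x)) * m%:R.
    case: pphi => -[pD _] _ _; rewrite mulr_natr.
    by elim: m => [|j IH]; [rewrite !mulr0n; have := pD 0 0; rewrite addr0; lra|rewrite !mulrS pD IH].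
  by rewrite -ler_pdivlMr.
have e4 : 0 <= e / 4 by rewrite divr_ge0// ltW.
have Zok z : nrm z <= 1 -> nrm (Z z) <= 1.
  by move=> z1; apply: nrm_sandwich => //; apply: saB => //; exact: sa1.
have Znear z g : nrm z <= 1 -> real_linear g -> dominates phi g ->
    `|g (Z z) - g Y| <= e.
  move=> z1 lg dg.
  have D w : nrm w <= 1 -> `|g (b * w)| <= e / 4 /\ `|g (w * b)| <= e / 4.
    by move=> w1; exact: dominated_small pphi dg sb w1 e4 phib.
  have Yb1 : nrm (Y * b) <= 1 by rewrite -[leRHS]mul1r; exact: nrmM_le.
  have zb1 : nrm (z * b) <= 1 by rewrite -[leRHS]mul1r; exact: nrmM_le.
  have -> : g (Z z) - g Y = g (b * (Y * b)) + g (b * (z * b)) - g (b * Y) - g (Y * b).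
    rewrite -real_linearB// -lg.1 -!real_linearB//; congr g.
    by rewrite /Z; Ncring_tac.non_commutative_ring.
  apply: le_trans (ler_normB _ _) _; have := (D _ Y1).2.
  have := ler_normB (g (b * (Y * b)) + g (b * (z * b))) (g (b * Y)); have := (D _ Y1).1.
  have := ler_normD (g (b * (Y * b))) (g (b * (z * b))).
  have := (D _ Yb1).1; have := (D _ zb1).1; lra.
have [z [z1 zfar]] : exists z, nrm z <= 1 /\
    forall k, box l k -> 8^-1 <= rnorm (P (Z z) - k).
  have [H|H] := pselect (forall k, box l k -> 8^-1 <= rnorm (P (Z (iota x)) - k)).
    by exists (iota x).
  exists (- iota x); split; first by rewrite nrmN.
  move=> k bk; rewrite leNgt; apply/negP => kZ; apply: H => k' bk'.
  rewrite leNgt; apply/negP => k'Z.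
  (* The half-difference of two points of the box lies in the box. *)
  pose c := (2^-1)%:C *: k' + (- 2^-1)%:C *: k.
  have bc : box l c.
    by apply: box_comb => //; rewrite normrN ger0_norm ?invr_ge0//; lra.
  have := xfar _ bc; apply/negP; rewrite -ltNge.
  have -> : x - c = P (iota x - b * iota x * b)
      + ((2^-1)%:C *: (P (Z (iota x)) - k') - (2^-1)%:C *: (P (Z (- iota x)) - k)).
    have Zd : (2^-1)%:C *: P (Z (iota x)) - (2^-1)%:C *: P (Z (- iota x))
        = P (b * iota x * b).
      rewrite -scalerBr -linearB.
      have -> : Z (iota x) - Z (- iota x) = b * iota x * b + b * iota x * b.
        by rewrite /Z; Ncring_tac.non_commutative_ring.
      by rewrite linearD -half_split.
    have swap (a a' d d' : E) : a - a' - (d - d') = a - d - (a' - d').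
      by rewrite !opprD !opprK addrACA.
    by rewrite linearB PK !scalerBr swap Zd addrA subrK /c rmorphN scaleNr.
  apply: le_lt_trans (rnormD _ _) _.
  have a1 : rnorm (P (iota x - b * iota x * b)) <= 16^-1.
    apply: le_trans (rnorm_P _) (le_trans _ M_m).
    by apply: ler_wpM2l bx; exact: ltW.
  have := rnormB ((2^-1)%:C *: (P (Z (iota x)) - k')) ((2^-1)%:C *: (P (Z (- iota x)) - k)).
  rewrite !rnormZr ger0_norm ?invr_ge0//; lra.
have [f [lf f1 fl]] := separation (@box_convex _ _ l) (ex_intro _ 0 (box0 l)) zfar.
have [chi [pchi dchi]] := functional_dominated (conj lf f1).
exists (Stage (Z z) (fun w => chi w + phi w) (P (Z z) :: l)); split.
  by split; [exact: Zok|exact: positive_functionalD].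
split => //=; first by move=> g lg dg; exact: Znear.
  move=> g dg w; have [d1 d2] := dominatesD pchi dg w.
  by rewrite ![chi _ + _]addrC.
by exists f; split => //; exact: dominatesD.
Qed.

(** A weak limit [y] of the images [P (cur (s n))] lies in the closure of the
    union [W] of the boxes, for otherwise [separation] would separate it from
    all of these images; let [v] be an element of some box, at distance less than
    1/32 from [y].  The functional [f] chosen at a later stage exceeds [f v] by
    1/8 at the next image, and changes by at most 1/32 on all subsequent ones, so
    [f y] exceeds [f v] by at least 3/32: a contradiction. *)
Lemma small_absurd : reflexive_space E -> False.
Proof.
move=> refl.
pose e (n : nat) : R := 32^-1 * 2^-1 ^+ n.+1.
have e0 n : 0 < e n by rewrite mulr_gt0 ?exprn_gt0 ?invr_gt0.
pose T := {s | stage_ok s}.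
have ok0 : stage_ok (Stage 0 (fun=> 0) [::]).
  by split; [rewrite /= nrm0 ler01|exact: positive_functional0].
have [|F HF] := @choice (nat * T) T
    (fun p q => stage_next (e p.1) (sval p.2) (sval q)).
  move=> [n [s oks]]; have [s' [oks' ss']] := stage_nextP (e0 n) oks.
  by exists (exist _ s' oks').
pose t := fix t n : T := if n is j.+1 then F (j, t j) else exist _ _ ok0.
pose s n := sval (t n).
have oks n : stage_ok (s n) := svalP (t n).
have ss n : stage_next (e n) (s n) (s n.+1) := HF (n, t n).
have Pbound n : rnorm (P (cur (s n))) <= M.
  apply: le_trans (rnorm_P _) _; rewrite -[leRHS]mulr1.
  by apply: ler_wpM2l; [exact: ltW|case: (oks n)].
have [y Hy] := reflexive_weak_limit refl (ltW M_gt0) Pbound.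
have past_mono n j k : box (past (s n)) k -> box (past (s (n + j)%N)) k.
  move=> bk; elim: j => [|j IH]; first by rewrite addn0.
  by rewrite addnS; have [-> _ _ _] := ss (n + j)%N; exact: box_cons.
pose W k := exists n, box (past (s n)) k.
have Wc : convex_subset W.
  move=> a b x z a0 b0 ab [n bx] [n' bz]; exists (n + n')%N.
  apply: box_convex => //; first exact: past_mono.
  by rewrite addnC; exact: past_mono.
have W0 : exists k, W k by exists 0, 0%N; exact: box0.
have [v [n bv] yv] : exists2 v, W v & rnorm (y - v) < 32^-1.
  apply: contrapT => H.
  have [k Wk|f [lf f1 fW]] := @separation _ _ W y 32^-1 Wc W0.
    by rewrite leNgt; apply/negP => yk; apply: H; exists k.
  have lf' : real_linear (fun x => - f x).
    by split=> [a b|a b]; rewrite ?lf.1 ?lf.2 ?opprD ?mulrN.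
  have f1' x : - f x <= rnorm x by rewrite -real_linearN// -rnormN.
  have := Hy (fun x => - f x) (- (f y - 32^-1)) lf' f1'.
  have H1 : exists n0 : nat, forall n, (n0 <= n)%N -> - (f y - 32^-1) <= - f (P (cur (s n))).
    exists 1%N => -[//|n] _; rewrite lerN2 lerBrDr; apply: fW; exists n.+1.
    by have [-> _ _ _] := ss n; exact: box_head.
  by move=> /(_ H1); lra.
have [_ _ _ [f [[lf f1] df fv]]] := ss n.
have lfP := (functional_P (conj lf f1)).1.
have dom j : dominates (ctl (s (n.+1 + j)%N)) (f \o P).
  elim: j => [|j IH]; first by rewrite addn0.
  by rewrite addnS; have [_ _ + _] := ss (n.+1 + j)%N; apply.
have near j : `|f (P (cur (s (n.+1 + j)%N))) - f (P (cur (s n.+1)))|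
    <= 32^-1 * (1 - 2^-1 ^+ j).
  elim: j => [|j IH]; first by rewrite addn0 !subrr normr0 mulr0.
  have [_ /(_ _ lfP (dom j)) /= nj _ _] := ss (n.+1 + j)%N.
  rewrite addnS -(subrKA (f (P (cur (s (n.+1 + j)%N))))).
  apply: le_trans (ler_normD _ _) (le_trans (lerD nj IH) _).
  have : e (n.+1 + j)%N <= 32^-1 * 2^-1 ^+ j.+1.
    rewrite ler_wpM2l ?invr_ge0// ler_wiXn2l ?invr_ge0// ?invf_le1 ?ler1n//.
    by rewrite ltnS addSn leqW// leq_addl.
  rewrite exprS; lra.
have : f (P (cur (s n.+1))) - 32^-1 <= f y.
  apply: Hy => //; exists n.+1 => k /subnKC <-.
  have := near (k - n.+1)%N; rewrite ler_norml => /andP[+ _].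
  have : 0 <= 2^-1 ^+ (k - n.+1)%N :> R by rewrite exprn_ge0 ?invr_ge0.
  lra.
have := fv _ bv; have := f1 (y - v); rewrite real_linearB//; lra.
Qed.

End complemented_reflexive.

(** * Unitization *)

Section complete_sequences.

Lemma complete_seq (K : numFieldType) (V : completeNormedModType K) (u : nat -> V) :
  (forall e, 0 < e -> exists N : nat, forall m n : nat,
     (N <= m)%N -> (N <= n)%N -> `|u m - u n| <= e) ->
  exists l, forall e, 0 < e -> exists N : nat, forall n : nat,
     (N <= n)%N -> `|u n - l| <= e.
Proof.
move=> uC; have uc : cvg (u @ \oo).
  apply: cauchy_cvg; apply: cauchy_exP => e e0.
  have e2 : 0 < e / 2 by rewrite divr_gt0.
  have [N HN] := uC _ e2.
  exists (u N); exists N => // n /= Nn; rewrite -ball_normE /=.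
  by apply: le_lt_trans (HN _ _ (leqnn N) Nn) _; rewrite gtr_pMr// invf_lt1// ltr1n.
exists (lim (u @ \oo)) => e e0.
have /cvgrPdist_le/(_ e e0)[N _ HN] := uc.
by exists N => n Nn; rewrite distrC; exact: HN.
Qed.

Context {R : realType}.

Lemma rnorm_complete (V : completeNormedModType R[i]) (u : nat -> V) :
  (forall e, 0 < e -> exists N : nat, forall m n : nat,
     (N <= m)%N -> (N <= n)%N -> rnorm (u m - u n) <= e) ->
  exists l, forall e, 0 < e -> exists N : nat, forall n : nat,
     (N <= n)%N -> rnorm (u n - l) <= e.
Proof.
move=> uC; have [e e0|l Hl] := @complete_seq _ V u.
  have e0' : 0 < complex.Re e by move: e0; rewrite ltcE => /andP[].
  have [N HN] := uC _ e0'; exists N => m n Nm Nn.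
  by rewrite rnormE -(RRe_real (gtr0_real e0)) lecR HN.
exists l => e e0; have [|N HN] := Hl e%:C; first by rewrite ltcR.
by exists N => n Nn; have := HN _ Nn; rewrite rnormE lecR.
Qed.

Lemma Re_norm_le (z : R[i]) : `|complex.Re z| <= complex.Re `|z|.
Proof.
by rewrite normc_def; case: z => a b /=; rewrite -sqrtr_sqr ler_wsqrtr// lerDl sqr_ge0.
Qed.

Lemma Im_norm_le (z : R[i]) : `|complex.Im z| <= complex.Re `|z|.
Proof.
by rewrite normc_def; case: z => a b /=; rewrite -sqrtr_sqr ler_wsqrtr// lerDr sqr_ge0.
Qed.

Lemma norm_Re_Im_le (z : R[i]) : complex.Re `|z| <= `|complex.Re z| + `|complex.Im z|.
Proof.
rewrite normc_def; case: z => a b /=.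
rewrite -[leRHS]ger0_norm ?addr_ge0// -sqrtr_sqr ler_wsqrtr// sqrrD !real_normK ?num_real//.
by rewrite lerD2r lerDl mulrn_wge0// mulr_ge0.
Qed.

Lemma complex_complete (u : nat -> R[i]) :
  (forall e, 0 < e -> exists N : nat, forall m n : nat,
     (N <= m)%N -> (N <= n)%N -> complex.Re `|u m - u n| <= e) ->
  exists l, forall e, 0 < e -> exists N : nat, forall n : nat,
     (N <= n)%N -> complex.Re `|u n - l| <= e.
Proof.
move=> uC.
have [e e0|a Ha] := @complete_seq _ R^o (fun n => complex.Re (u n)).
  have [N HN] := uC _ e0; exists N => m n Nm Nn.
  apply: le_trans (HN _ _ Nm Nn); apply: le_trans (Re_norm_le _).
  by case: (u m) (u n) => ? ? [].
have [e e0|b Hb] := @complete_seq _ R^o (fun n => complex.Im (u n)).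
  have [N HN] := uC _ e0; exists N => m n Nm Nn.
  apply: le_trans (HN _ _ Nm Nn); apply: le_trans (Im_norm_le _).
  by case: (u m) (u n) => ? ? [].
exists (a +i* b)%C => e e0.
have e2 : 0 < e / 2 by rewrite divr_gt0.
have [N HN] := Ha _ e2; have [N' HN'] := Hb _ e2.
exists (maxn N N') => n; rewrite geq_max => /andP[nN nN'].
apply: le_trans (norm_Re_Im_le _) _.
have := HN _ nN; have := HN' _ nN'.
by case: (u n) => c d /=; lra.
Qed.

End complete_sequences.

Section unitization.
Context {R : realType} (A : cstarAlgType R).
Implicit Types (a b : A).

Definition unitization : Type := A * R[i]^o.

HB.instance Definition _ := GRing.Lmodule.on unitization.

Implicit Types (x y : unitization).

Definition unit_one : unitization := (0, 1).

Definition unit_mul x y : unitization :=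
  (cmul x.1 y.1 + x.2 *: y.1 + y.2 *: x.1, x.2 * y.2).

Lemma cmul0r a : cmul 0 a = 0.
Proof. by have := cmulZl 0 0 a; rewrite !scale0r. Qed.

Lemma cmulr0 a : cmul a 0 = 0.
Proof. by have := cmulZr 0 a 0; rewrite !scale0r. Qed.

Lemma unit_mulA : associative unit_mul.
Proof.
move=> [a p] [b q] [c r]; rewrite /unit_mul/=; congr (_, _); last exact: mulrA.
rewrite !cmulDl !cmulDr !cmulZl !cmulZr cmulA !scalerDr !scalerA.
rewrite (mulrC r p) (mulrC r q) !addrA.
by rewrite [LHS](ACl (1*4*2*5*3*6*7)).
Qed.

Lemma unit_mul1r : left_id unit_one unit_mul.
Proof.
by move=> [a p]; rewrite /unit_mul/= cmul0r add0r scale1r scaler0 addr0 mul1r.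
Qed.

Lemma unit_mulr1 : right_id unit_one unit_mul.
Proof.
by move=> [a p]; rewrite /unit_mul/= cmulr0 add0r scale1r scaler0 add0r mulr1.
Qed.

Lemma unit_mulDl : left_distributive unit_mul +%R.
Proof.
move=> [a p] [b q] [c r]; rewrite /unit_mul/=; congr (_, _); last exact: mulrDl.
by rewrite cmulDl scalerDl scalerDr !addrA [LHS](ACl (1*3*5*2*4*6)).
Qed.

Lemma unit_mulDr : right_distributive unit_mul +%R.
Proof.
move=> [a p] [b q] [c r]; rewrite /unit_mul/=; congr (_, _); last exact: mulrDr.
by rewrite cmulDr scalerDl scalerDr !addrA [LHS](ACl (1*3*5*2*4*6)).
Qed.

Lemma unit_one_neq0 : unit_one != 0.
Proof. by apply/eqP => -[/eqP]; rewrite oner_eq0. Qed.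

HB.instance Definition _ := GRing.Zmodule_isNzRing.Build unitization
  unit_mulA unit_mul1r unit_mulr1 unit_mulDl unit_mulDr unit_one_neq0.

Lemma unit_scalerAl (k : R[i]) x y : k *: (x * y) = (k *: x) * y.
Proof.
case: x y => [a p] [b q]; congr (_, _); rewrite /=; last exact: mulrA.
by rewrite !scalerDr !cmulZl !scalerA (mulrC k q).
Qed.

Lemma unit_scalerAr (k : R[i]) x y : k *: (x * y) = x * (k *: y).
Proof.
case: x y => [a p] [b q]; congr (_, _); rewrite /=; last by rewrite [RHS]mulrCA.
by rewrite !scalerDr !cmulZr !scalerA (mulrC k p).
Qed.

HB.instance Definition _ :=
  GRing.Lmodule_isLalgebra.Build R[i] unitization unit_scalerAl.
HB.instance Definition _ :=
  GRing.Lalgebra_isAlgebra.Build R[i] unitization unit_scalerAr.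

Lemma rnorm_cmul_le a b : rnorm (cmul a b) <= rnorm a * rnorm b.
Proof. by rewrite -lecR real_complexM -!rnormE norm_cmul_le. Qed.

Lemma rnorm_cstar_cmul a : rnorm (cmul (cstar a) a) = rnorm a ^+ 2.
Proof. by have := norm_cstar_cmul a; rewrite !rnormE -rmorphXn => /complexI. Qed.

Lemma rnorm_eq0 a : rnorm a = 0 -> a = 0.
Proof. by move=> a0; apply: normr0_eq0; rewrite rnormE a0. Qed.

Lemma rnorm_cstar a : rnorm (cstar a) = rnorm a.
Proof.
suff H b : rnorm b <= rnorm (cstar b).
  by apply/eqP; rewrite eq_le H andbT; have := H (cstar a); rewrite cstarK.
have [b0|b0] := eqVneq (rnorm b) 0; first by rewrite b0 rnorm_ge0.
have bp : 0 < rnorm b by rewrite lt_neqAle eq_sym b0 rnorm_ge0.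
by rewrite -(ler_pM2r bp) -expr2 -rnorm_cstar_cmul rnorm_cmul_le.
Qed.

(** [x], seen as an operator on the ideal [A] of its unitization. *)
Definition unit_act x b : A := cmul x.1 b + x.2 *: b.

(** Left multiplication need not separate the points of the unitization when
    [A] already has a unit; bounding the scalar part as well repairs this. *)
Definition unit_bound x (k : R) :=
  complex.Re `|x.2| <= k /\ forall b, rnorm (unit_act x b) <= k * rnorm b.

Definition unit_nrm x : R := inf [set k | unit_bound x k].

Lemma unit_act_mul x y b : unit_act (x * y) b = unit_act x (unit_act y b).
Proof.
case: x y => [a p] [c q]; rewrite /unit_act/= cmulDr !cmulDl !cmulZl !cmulZr cmulA.
by rewrite !scalerDr !scalerA !addrA [LHS](ACl (1*3*2*4)).
Qed.

Lemma unit_bound_nonempty x : unit_bound x (rnorm x.1 + complex.Re `|x.2|).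
Proof.
split; first by rewrite lerDr rnorm_ge0.
move=> b; apply: le_trans (rnormD _ _) _; rewrite rnormZ mulrDl lerD2r.
exact: rnorm_cmul_le.
Qed.

Lemma unit_bound_lb x : has_lbound [set k | unit_bound x k].
Proof. by exists (complex.Re `|x.2|) => k []. Qed.

Lemma unit_nrm_le x k : unit_bound x k -> unit_nrm x <= k.
Proof. by move=> xk; apply: ge_inf => //; exact: unit_bound_lb. Qed.

Lemma unit_nrm_bound x : unit_bound x (unit_nrm x).
Proof.
have x0 : [set k | unit_bound x k] !=set0 by eexists; exact: unit_bound_nonempty.
split; first by apply: lb_le_inf => // k [].
move=> b; have [b0|b0] := eqVneq (rnorm b) 0.
  by have [_ /(_ b)] := unit_bound_nonempty x; rewrite b0 !mulr0.
have bp : 0 < rnorm b by rewrite lt_neqAle eq_sym b0 rnorm_ge0.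
rewrite -ler_pdivrMr//; apply: lb_le_inf => // k [_ /(_ b)].
by rewrite ler_pdivrMr.
Qed.

Lemma unit_nrm_ge0 x : 0 <= unit_nrm x.
Proof. by have [+ _] := unit_nrm_bound x; apply: le_trans; exact: complex_Re_norm_ge0. Qed.

Lemma unit_nrmD x y : unit_nrm (x + y) <= unit_nrm x + unit_nrm y.
Proof.
have [x1 x2] := unit_nrm_bound x; have [y1 y2] := unit_nrm_bound y.
apply: unit_nrm_le; split.
  by apply: le_trans (rnormD (x.2 : R[i]^o) y.2) _; exact: lerD.
move=> b; have -> : unit_act (x + y) b = unit_act x b + unit_act y b.
  by rewrite /unit_act/= cmulDl scalerDl addrACA.
by apply: le_trans (rnormD _ _) _; rewrite mulrDl lerD.
Qed.

Lemma unit_nrmZ_le (k : R[i]) x : unit_nrm (k *: x) <= complex.Re `|k| * unit_nrm x.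
Proof.
have [x1 x2] := unit_nrm_bound x; have k0 := complex_Re_norm_ge0 k.
apply: unit_nrm_le; split.
  by have := rnormZ k (x.2 : R[i]^o); rewrite /rnorm => ->; rewrite ler_wpM2l.
move=> b; have -> : unit_act (k *: x) b = k *: unit_act x b.
  by rewrite /unit_act/= cmulZl scalerDr scalerA.
by rewrite rnormZ -mulrA ler_wpM2l.
Qed.

Lemma unit_nrmZ (k : R[i]) x : unit_nrm (k *: x) = complex.Re `|k| * unit_nrm x.
Proof.
apply/eqP; rewrite eq_le unit_nrmZ_le andTb.
have [->|k0] := eqVneq k 0; first by rewrite normr0 mul0r unit_nrm_ge0.
have kp : 0 < complex.Re `|k| by rewrite -ltcR complex_Re_norm normr_gt0.
have := unit_nrmZ_le k^-1 (k *: x); rewrite scalerA mulVf// scale1r normfV.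
have -> : complex.Re (`|k|^-1) = (complex.Re `|k|)^-1.
  by rewrite -[`|k|]complex_Re_norm -fmorphV.
by rewrite ler_pdivlMl.
Qed.

Lemma unit_nrmM x y : unit_nrm (x * y) <= unit_nrm x * unit_nrm y.
Proof.
have [x1 x2] := unit_nrm_bound x; have [y1 y2] := unit_nrm_bound y.
apply: unit_nrm_le; split.
  have -> : (x * y).2 = x.2 * y.2 :> R[i] by [].
  rewrite normrM -(complex_Re_norm x.2) complex_ReM.
  by apply: ler_pM => //; exact: complex_Re_norm_ge0.
move=> b; rewrite unit_act_mul; apply: le_trans (x2 _) _; rewrite -mulrA.
by rewrite ler_wpM2l// unit_nrm_ge0.
Qed.

Definition unit_embed a : unitization := (a, 0).

Lemma unit_nrm_embed a : unit_nrm (unit_embed a) = rnorm a.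
Proof.
apply/eqP; rewrite eq_le; apply/andP; split.
  apply: unit_nrm_le; split; first by rewrite [`|_|]normr0 rnorm_ge0.
  by move=> b; rewrite /unit_act/= scale0r addr0 rnorm_cmul_le.
have [a0|a0] := eqVneq (rnorm a) 0; first by rewrite a0 unit_nrm_ge0.
have ap : 0 < rnorm a by rewrite lt_neqAle eq_sym a0 rnorm_ge0.
have [_ /(_ (cstar a))] := unit_nrm_bound (unit_embed a).
rewrite /unit_act/= scale0r addr0 -{1}(cstarK a) rnorm_cstar_cmul rnorm_cstar expr2.
by rewrite ler_pM2r.
Qed.

Lemma unit_nrm_eq0 x : unit_nrm x = 0 -> x = 0.
Proof.
move=> x0; have [+ _] := unit_nrm_bound x; rewrite x0 => x2.
have {}x2 : x.2 = 0.
  by apply: normr0_eq0; rewrite -complex_Re_norm (@le_anti _ _ (complex.Re _) 0)// x2 complex_Re_norm_ge0.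
move: x0 x2; case: x => a p /= + p0; rewrite p0 unit_nrm_embed => /rnorm_eq0 ->.
by [].
Qed.

Definition unit_star x : unitization := (cstar x.1, conjc x.2).

Lemma unit_starK : involutive unit_star.
Proof. by move=> [a p]; rewrite /unit_star/= cstarK conjcK. Qed.

Lemma unit_starD : {morph unit_star : x y / x + y}.
Proof. by move=> [a p] [b q]; rewrite /unit_star/= cstarD rmorphD. Qed.

Lemma unit_starZ (k : R[i]) x : unit_star (k *: x) = conjc k *: unit_star x.
Proof.
case: x => a p; congr (_, _); first exact: cstarZ.
exact: (rmorphM (@conjc R)).
Qed.

Lemma unit_starM x y : unit_star (x * y) = unit_star y * unit_star x.
Proof.
case: x y => [a p] [b q]; congr (_, _) => /=; last by rewrite rmorphM mulrC.
by rewrite !cstarD !cstarZ cstarM addrAC.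
Qed.

Lemma unit_act_star x b : cmul (cstar (unit_act x b)) (unit_act x b) =
  cmul (cstar b) (unit_act (unit_star x * x) b).
Proof.
rewrite unit_act_mul; set z := unit_act x b.
rewrite {1}/z {1}/unit_act cstarD cstarM cstarZ cmulDl cmulZl -cmulA.
by rewrite [RHS]cmulDr cmulZr.
Qed.

Lemma unit_nrm_sqr_le x : unit_nrm x ^+ 2 <= unit_nrm (unit_star x * x).
Proof.
set k := unit_nrm (unit_star x * x); have [k1 k2] := unit_nrm_bound (unit_star x * x).
have k0 : 0 <= k := unit_nrm_ge0 _.
have H t : 0 <= t -> t ^+ 2 <= k -> t <= Num.sqrt k.
  by move=> t0 tk; rewrite -(ger0_norm t0) -sqrtr_sqr ler_wsqrtr.
rewrite -[leRHS]sqr_sqrtr// ler_sqr ?nnegrE ?sqrtr_ge0 ?unit_nrm_ge0//.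
apply: unit_nrm_le; split.
  apply: H; first exact: complex_Re_norm_ge0.
  apply: le_trans k1; have -> : (unit_star x * x).2 = conjc x.2 * x.2 :> R[i] by [].
  rewrite normrM normcJ -(complex_Re_norm x.2) complex_ReM.
  by rewrite expr2 complex_Re_norm.
move=> b; rewrite -[leRHS]ger0_norm ?mulr_ge0 ?sqrtr_ge0 ?rnorm_ge0//.
rewrite -sqrtr_sqr exprMn sqr_sqrtr// -[leLHS]ger0_norm ?rnorm_ge0//.
rewrite -sqrtr_sqr ler_wsqrtr// -rnorm_cstar_cmul unit_act_star.
apply: le_trans (rnorm_cmul_le _ _) _; rewrite rnorm_cstar mulrC expr2 mulrA.
by rewrite ler_wpM2r ?rnorm_ge0// k2.
Qed.

Lemma unit_nrm_star x : unit_nrm (unit_star x) = unit_nrm x.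
Proof.
suff H y : unit_nrm y <= unit_nrm (unit_star y).
  by apply/eqP; rewrite eq_le H andbT; have := H (unit_star x); rewrite unit_starK.
have [y0|y0] := eqVneq (unit_nrm y) 0; first by rewrite y0 unit_nrm_ge0.
have yp : 0 < unit_nrm y by rewrite lt_neqAle eq_sym y0 unit_nrm_ge0.
rewrite -(ler_pM2r yp) -expr2; apply: le_trans (unit_nrm_sqr_le _) _.
exact: unit_nrmM.
Qed.

Lemma unit_nrm_starM x : unit_nrm (unit_star x * x) = unit_nrm x ^+ 2.
Proof.
apply/eqP; rewrite eq_le unit_nrm_sqr_le andbT expr2 -{1}(unit_nrm_star x).
exact: unit_nrmM.
Qed.

Lemma rnorm_fst_le x : rnorm x.1 <= 2 * unit_nrm x.
Proof.
have [x2 _] := unit_nrm_bound x.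
have -> : rnorm x.1 = unit_nrm (x + (- x.2) *: 1).
  rewrite -unit_nrm_embed; congr unit_nrm; case: x {x2} => a p.
  by congr (_, _); rewrite /= ?scaler0 ?addr0// [_ *: _]mulr1 subrr.
apply: le_trans (unit_nrmD _ _) _; rewrite unit_nrmZ normrN.
have : unit_nrm 1 <= 1.
  apply: unit_nrm_le; split; first by rewrite [`|_|]normr1.
  by move=> b; rewrite /unit_act/= cmul0r add0r scale1r mul1r.
have := complex_Re_norm_ge0 x.2; have := unit_nrm_ge0 1; nra.
Qed.

Lemma unit_complete (u : nat -> unitization) :
  (forall e, 0 < e -> exists N : nat, forall m n : nat,
     (N <= m)%N -> (N <= n)%N -> unit_nrm (u m - u n) <= e) ->
  exists l, forall e, 0 < e -> exists N : nat, forall n : nat,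
     (N <= n)%N -> unit_nrm (u n - l) <= e.
Proof.
move=> uC.
have [e e0|a Ha] := @rnorm_complete _ A (fun n => (u n).1).
  have e2 : 0 < e / 2 by rewrite divr_gt0.
  have [N HN] := uC _ e2; exists N => m n Nm Nn.
  by apply: le_trans (rnorm_fst_le (u m - u n)) _; have := HN _ _ Nm Nn; lra.
have [e e0|p Hp] := @complex_complete _ (fun n => (u n).2).
  have [N HN] := uC _ e0; exists N => m n Nm Nn.
  by have [+ _] := unit_nrm_bound (u m - u n); move=> /le_trans; apply; exact: HN.
exists (a, p) => e e0; have e2 : 0 < e / 2 by rewrite divr_gt0.
have [N HN] := Ha _ e2; have [N' HN'] := Hp _ e2.
exists (maxn N N') => n; rewrite geq_max => /andP[nN nN'].
apply: le_trans (unit_nrm_le (unit_bound_nonempty _)) _.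
by apply: le_trans (lerD (HN _ nN) (HN' _ nN')) _; lra.
Qed.

HB.instance Definition _ := isUnitalCStar.Build R unitization
  unit_nrmD unit_nrmZ unit_nrm_eq0 unit_nrmM unit_starK unit_starD unit_starZ
  unit_starM unit_nrm_starM unit_complete.

Lemma unit_embed_linear : linear unit_embed.
Proof. by move=> k a b; congr (_, _); rewrite /= scaler0 addr0. Qed.

HB.instance Definition _ := GRing.isLinear.Build R[i] A unitization _ unit_embed
  unit_embed_linear.

End unitization.

(** * Equivalent Hilbert norms *)

(** A sesquilinear form whose norm is equivalent to the given one.  The bounds
    enter through their square roots, the constants between the norms. *)
Record hilbert_form {R : realType} (E : normedModType R[i]) := HilbertForm {
  form : E -> E -> R[i];
  formDl : forall x y z, form (x + y) z = form x z + form y z;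
  formZl : forall a x z, form (a *: x) z = a * form x z;
  formC : forall x y, form x y = conjc (form y x);
  form_lo : R;
  form_hi : R;
  form_lo_gt0 : 0 < form_lo;
  form_ge : forall x, form_lo ^+ 2 * rnorm x ^+ 2 <= complex.Re (form x x);
  form_le : forall x, complex.Re (form x x) <= form_hi ^+ 2 * rnorm x ^+ 2;
  form_complete : forall F : set_system E, ProperFilter F -> cauchy F -> cvg F
}.

Section renorming.
Context {R : realType} {E : normedModType R[i]} (h : hilbert_form E).
Implicit Types x y z : E.
Local Notation f := (form h).

Lemma formDr x y z : f x (y + z) = f x y + f x z.
Proof. by rewrite formC formDl rmorphD/= -!formC. Qed.

Lemma formZr a x y : f x (a *: y) = conjc a * f x y.
Proof. by rewrite formC formZl rmorphM/= -formC. Qed.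

Definition form_nrm x : R := Num.sqrt (complex.Re (f x x)).

Lemma form_sqr_ge0 x : 0 <= complex.Re (f x x).
Proof. by apply: le_trans (form_ge h x); rewrite mulr_ge0 ?sqr_ge0. Qed.

Lemma form_real x : f x x = (form_nrm x ^+ 2)%:C.
Proof.
rewrite sqr_sqrtr ?form_sqr_ge0//; have := formC h x x.
by case: (f x x) => a b [] /eqP; rewrite -subr_eq0 opprK -mulr2n mulrn_eq0/= => /eqP ->.
Qed.

Lemma form_nrm_ge x : form_lo h * rnorm x <= form_nrm x.
Proof.
have H : 0 <= form_lo h * rnorm x.
  by rewrite mulr_ge0 ?rnorm_ge0// ltW// form_lo_gt0.
by rewrite -[leLHS]ger0_norm// -sqrtr_sqr ler_wsqrtr// exprMn form_ge.
Qed.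

Lemma form_nrm_le x : form_nrm x <= `|form_hi h| * rnorm x.
Proof.
rewrite -(ger0_norm (rnorm_ge0 x)) -normrM -sqrtr_sqr ler_wsqrtr// exprMn.
exact: form_le.
Qed.

Lemma form_nrm_eq0 x : form_nrm x = 0 -> x = 0.
Proof.
move=> x0; have := form_nrm_ge x; rewrite x0 pmulr_rle0 ?form_lo_gt0// => xr.
by apply: normr0_eq0; rewrite rnormE (@le_anti _ _ (rnorm x) 0)// xr rnorm_ge0.
Qed.

Lemma form_nrmZ a x : form_nrm (a *: x) = complex.Re `|a| * form_nrm x.
Proof.
rewrite /form_nrm formZl formZr mulrA -sqr_normc form_real -complex_Re_norm.
rewrite -rmorphXn complex_ReM /= sqrtrM ?sqr_ge0// sqrtr_sqr.
by rewrite ger0_norm ?complex_Re_norm_ge0// form_real/=.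
Qed.

Lemma form_cauchy_schwarz x y : complex.Re (f x y) <= form_nrm x * form_nrm y.
Proof.
have [x0|x0] := eqVneq (form_nrm x) 0.
  by rewrite x0 mul0r (form_nrm_eq0 x0) -(scale0r 0) formZl mul0r.
have [y0|y0] := eqVneq (form_nrm y) 0.
  by rewrite y0 mulr0 (form_nrm_eq0 y0) -(scale0r 0) formZr conjc0 mul0r.
have xp : 0 < form_nrm x by rewrite lt_neqAle eq_sym x0 sqrtr_ge0.
have yp : 0 < form_nrm y by rewrite lt_neqAle eq_sym y0 sqrtr_ge0.
have := form_sqr_ge0 ((form_nrm y)%:C *: x + (- form_nrm x)%:C *: y).
rewrite formDl !formDr !formZl !formZr !conjc_real !complex_ReD !complex_ReM.
rewrite !form_real /= [f y x]formC.
have -> : complex.Re (conjc (f x y)) = complex.Re (f x y) by case: (f x y).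
move=> H; have : 0 <= (form_nrm x * form_nrm y) * (form_nrm x * form_nrm y - complex.Re (f x y)).
  by move: H; rewrite !expr2; lra.
by rewrite pmulr_rge0 ?mulr_gt0// subr_ge0.
Qed.

Lemma form_nrmD x y : form_nrm (x + y) <= form_nrm x + form_nrm y.
Proof.
have H : 0 <= form_nrm x + form_nrm y by rewrite addr_ge0 ?sqrtr_ge0.
rewrite -[leRHS]ger0_norm// -sqrtr_sqr ler_wsqrtr//.
rewrite formDl !formDr !complex_ReD [f y x]formC.
have -> : complex.Re (conjc (f x y)) = complex.Re (f x y) by case: (f x y).
by rewrite !form_real /= sqrrD; have := form_cauchy_schwarz x y; lra.
Qed.

(** The alias carries the norm of the form [h], on which it depends. *)
Definition renormed : Type := E.

HB.instance Definition _ := GRing.Lmodule.on renormed.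

Definition renormed_norm (x : renormed) : R[i] := (form_nrm x)%:C.

Lemma renormed_normD (x y : renormed) :
  renormed_norm (x + y) <= renormed_norm x + renormed_norm y.
Proof. by rewrite /renormed_norm -real_complexD lecR form_nrmD. Qed.

Lemma renormed_normZ a (x : renormed) :
  renormed_norm (a *: x) = `|a| * renormed_norm x.
Proof. by rewrite /renormed_norm form_nrmZ real_complexM complex_Re_norm. Qed.

Lemma renormed_norm_eq0 (x : renormed) : renormed_norm x = 0 -> x = 0.
Proof. by move=> /complexI/form_nrm_eq0. Qed.

HB.instance Definition _ := Lmodule_isNormed.Build R[i] renormed
  renormed_normD renormed_normZ renormed_norm_eq0.

Lemma renormedE (x : renormed) : `|x| = (form_nrm x)%:C.
Proof. by []. Qed.

Lemma renormed_complete (F : set_system renormed) :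
  ProperFilter F -> cauchy F -> cvg F.
Proof.
move=> FF /cauchyP Fc.
have l0 := form_lo_gt0 h.
have Ec : cauchy (F : set_system E).
  apply: cauchy_exP => e e0.
  have [|x Fx] := Fc ((form_lo h)%:C * e); first by rewrite mulr_gt0// ltcR.
  exists x; apply: filterS Fx => y; rewrite -!ball_normE /= renormedE => H.
  rewrite -(ltr_pM2l (_ : 0 < (form_lo h)%:C)) ?ltcR//.
  by apply: le_lt_trans H; rewrite rnormE -real_complexM lecR form_nrm_ge.
have /cvg_ex[l /cvg_ballP Fl] := form_complete h FF Ec.
apply/cvg_ex; exists l; apply/cvg_ballP => e e0.
have k0 : 0 < (`|form_hi h| + 1)%:C :> R[i] by rewrite ltcR ltr_wpDl.
have := Fl (e / (`|form_hi h| + 1)%:C) (divr_gt0 e0 k0).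
apply: filterS => y; rewrite -!ball_normE /= renormedE ltr_pdivlMr// => H.
apply: le_lt_trans H; rewrite rnormE -real_complexM lecR.
apply: le_trans (form_nrm_le _) _; rewrite mulrC ler_wpM2l ?rnorm_ge0//.
by rewrite lerDl ler01.
Qed.

HB.instance Definition _ := Uniform_isComplete.Build renormed renormed_complete.

Definition renormed_form (x y : renormed) : R[i] := f x y.

Lemma renormed_form_zmodl u : zmod_morphism (renormed_form ^~ u).
Proof.
by move=> x y; rewrite /renormed_form formDl -scaleN1r formZl mulN1r.
Qed.

Lemma renormed_form_zmodr u : zmod_morphism (renormed_form u).
Proof.
by move=> x y; rewrite /renormed_form formDr -scaleN1r formZr rmorphN1 mulN1r.
Qed.

Lemma renormed_form_scalel u : scalable_for *%R (renormed_form ^~ u).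
Proof. by move=> a x; exact: formZl. Qed.

Lemma renormed_form_scaler u : scalable_for (@conjc R \; *%R) (renormed_form u).
Proof. by move=> a x; exact: formZr. Qed.

HB.instance Definition _ := isBilinear.Build R[i] renormed renormed R[i]
  *%R (@conjc R \; *%R) renormed_form renormed_form_zmodl renormed_form_zmodr
  renormed_form_scalel renormed_form_scaler.

Lemma renormed_form_hermitian (x y : renormed) :
  renormed_form x y = (-1) ^+ false * conjc (renormed_form y x).
Proof. by rewrite expr0 mul1r; exact: formC. Qed.

HB.instance Definition _ := isHermitianSesquilinear.Build R[i] renormed false
  (@conjc R) renormed_form renormed_form_hermitian.

Lemma renormed_form_gt0 (x : renormed) : x != 0 -> 0 < renormed_form x x.
Proof.
move=> x0; rewrite /renormed_form form_real ltcR exprn_gt0// lt_neqAle sqrtr_ge0 andbT.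
by apply: contra_neq x0 => /esym/form_nrm_eq0.
Qed.

HB.instance Definition _ := isDotProduct.Build R[i] renormed renormed_form
  renormed_form_gt0.

Definition to_renormed (x : E) : renormed := x.

Lemma to_renormed_linear : linear to_renormed.
Proof. by []. Qed.

HB.instance Definition _ := GRing.isLinear.Build R[i] E renormed _ to_renormed
  to_renormed_linear.

Lemma hilbert_form_isomorphic : exists K : completeNormedModType R[i],
  hilbert_space K /\ isomorphic E K.
Proof.
exists renormed; split.
  by exists renormed_form => x; rewrite renormedE [RHS]form_real rmorphXn.
exists to_renormed, (fun x : renormed => (x : E)); split => //.
  by exists `|form_hi h| => x; rewrite renormedE rnormE -real_complexM lecR form_nrm_le.
exists (form_lo h)^-1 => x; rewrite renormedE rnormE -real_complexM lecR.
by rewrite ler_pdivlMl ?form_lo_gt0// form_nrm_ge.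
Qed.

End renorming.

(** * The Hilbert norm on a complemented reflexive subspace *)

Section hilbert_norm.
Context {R : realType}.

(** Averaging [phi] over [star] makes it vanish on [i] times self-adjoint
    elements, so that its complexification is hermitian. *)
Lemma hermitian_extension (B : unitalCStarType R) (phi : B -> R) :
  positive_functional phi -> exists Phi : B -> R[i],
    [/\ linear (Phi : B -> R[i]^o), forall x, Phi (star x) = conjc (Phi x) &
        forall x, sa x -> Phi x = (phi x)%:C].
Proof.
move=> [lphi _ _]; pose psi x := 2^-1 * (phi x + phi (star x)).
have lpsi : real_linear psi.
  split=> [x y|t x]; first by rewrite /psi starD !lphi.1; ring.
  by rewrite /psi starZr !lphi.2; ring.
have psi_star x : psi (star x) = psi x by rewrite /psi starK addrC.
have psi_i x : psi ('i%C *: star x) = - psi ('i%C *: x).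
  rewrite -psi_star starZ conjc_im starK scaleNr; exact: real_linearN.
exists (complexify psi); split => [|x|x sx]; first exact: complexify_linear.
  by rewrite /complexify psi_i psi_star.
have xi : psi ('i%C *: x) = 0.
  by have := psi_i x; rewrite sx; lra.
rewrite /complexify xi oppr0; congr Complex.
by rewrite /psi sx; lra.
Qed.

(** [small_absurd], after rescaling to unit vectors. *)
Lemma reflexive_complemented_lower_bound (B : unitalCStarType R)
    (E : normedModType R[i]) (iota : {linear E -> B}) (P : {linear B -> E}) (M : R) :
  (forall x, nrm (iota x) = rnorm x) -> (forall x, rnorm (P x) <= M * nrm x) ->
  (forall x, P (iota x) = x) -> 0 < M -> reflexive_space E ->
  exists phi e, [/\ positive_functional phi, 0 < e &
    forall x : E, e * rnorm x ^+ 2 <= phi (sqr_symm (iota x))].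
Proof.
move=> io PM PK M0 refl; apply: contrapT => H.
apply: (small_absurd io PM PK M0 _ refl) => phi pphi e e0.
apply: contrapT => H'; apply: H; exists phi, e; split => // x.
have [x0|x0] := eqVneq (rnorm x) 0.
  rewrite x0 expr0n mulr0; apply: positive_functional_ge0 => //; exact: pos_symm.
have xp : 0 < rnorm x by rewrite lt_neqAle eq_sym x0 rnorm_ge0.
pose y := (rnorm x)^-1%:C *: x.
have y1 : rnorm y = 1 by rewrite rnormZr gtr0_norm ?invr_gt0// mulVf.
have xy : x = (rnorm x)%:C *: y by rewrite scalerA -rmorphM mulfV// scale1r.
have ey : e <= phi (sqr_symm (iota y)).
  by rewrite leNgt; apply/negP => ye; apply: H'; exists y; split => //; exact: ltW.
have -> : sqr_symm (iota x) = (rnorm x ^+ 2)%:C *: sqr_symm (iota y).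
  rewrite {1}xy linearZ /sqr_symm starZr -!scalerAl -!scalerAr !scalerM scalerDr.
  by rewrite expr2.
case: (pphi) => lphi _ _; rewrite lphi.2 mulrC ler_wpM2l ?sqr_ge0//.
Qed.

End hilbert_norm.

Section subspace.
Context {R : realType} {A : cstarAlgType R} {S : set A}.
Variable linS : submod_closed [in S].
Local Notation E := (subspace_of linS).

Lemma subspace_complete : closed S -> forall F : set_system E,
  ProperFilter F -> cauchy F -> cvg F.
Proof.
move=> clS F FF /cauchyP Fc.
have /cvg_ex[a Ga] : cvg ((val : E -> A) @ F).
  apply: cauchy_cvg; apply: cauchy_exP => e e0; have [x Fx] := Fc e e0.
  exists (val x); apply: filterS Fx => y; rewrite -!ball_normE.
  exact.
have aS : a \in subspace_pred linS.
  apply/mem_set/clS => B /Ga FB; have [x Bx] := filter_ex (FB : F ((val : E -> A) @^-1` B)).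
  by exists (val x); split => //; have := valP x; exact: set_mem.
apply/cvg_ex; exists (exist _ a aS : E); apply/cvg_ballP => e e0.
have /cvg_ballP/(_ e e0) := Ga.
by apply: filterS => y; rewrite -!ball_normE.
Qed.

Definition subspace_embed (x : E) : unitization A := unit_embed (val x).

Lemma subspace_embed_linear : linear subspace_embed.
Proof. by move=> k x y; rewrite /subspace_embed !linearP. Qed.

HB.instance Definition _ := GRing.isLinear.Build R[i] E (unitization A) _
  subspace_embed subspace_embed_linear.

Variables (P : {linear A -> A}) (rangeP : range P = S).

Lemma subspace_proj_mem x : P x \in subspace_pred linS.
Proof. by apply/mem_set; rewrite -rangeP; exists x. Qed.

Definition subspace_proj (x : unitization A) : E := exist _ (P x.1) (subspace_proj_mem x.1).

Lemma subspace_proj_linear : linear subspace_proj.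
Proof. by move=> k x y; apply: val_inj => /=; rewrite linearP. Qed.

HB.instance Definition _ := GRing.isLinear.Build R[i] (unitization A) E _
  subspace_proj subspace_proj_linear.

End subspace.

Theorem theorem2 (R : realType) (A : cstarAlgType R) (S : set A)
    (linS : submod_closed [in S]) (closedS : closed S)
    (reflS : reflexive_space (subspace_of linS))
    (complS : complemented S) :
  exists K : completeNormedModType R[i],
    hilbert_space K /\ isomorphic (subspace_of linS) K.
Proof.
have [P [[M PM] Pid rangeP]] := complS.
(* The projection is transported to the unitization, through the first
   component. *)
pose iota : {linear subspace_of linS -> unitization A} := @subspace_embed R A S linS.
pose Q : {linear unitization A -> subspace_of linS} := subspace_proj linS rangeP.
have io x : nrm (iota x) = rnorm x by exact: unit_nrm_embed.
have M0 : 0 < 2 * `|M| + 1 by rewrite ltr_wpDl// mulr_ge0.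
have QM x : rnorm (Q x) <= (2 * `|M| + 1) * nrm x.
  have : rnorm (Q x) <= M * rnorm x.1.
    by rewrite -lecR real_complexM -!rnormE; exact: PM.
  have := rnorm_fst_le x; have := ler_norm M; have := normr_ge0 M.
  have := rnorm_ge0 x.1; rewrite -[nrm x]/(unit_nrm x); nra.
have QK x : Q (iota x) = x.
  apply: val_inj => /=; have fixS u : S u -> P u = u.
    by rewrite -rangeP => -[y _ <-]; exact: Pid.
  by apply: fixS; have := valP x; exact: set_mem.
have [phi [e [pphi e0 phie]]] := reflexive_complemented_lower_bound io QM QK M0 reflS.
have [Phi [lPhi PhiC Phisa]] := hermitian_extension pphi.
have [_ _ [K K0 phiK]] := pphi.
pose f (x y : subspace_of linS) : R[i] :=
  Phi (star (iota y) * iota x + iota x * star (iota y)).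
have fxx x : f x x = (phi (sqr_symm (iota x)))%:C.
  by rewrite /f Phisa//; exact: pos_sa (pos_symm _).
have PhiD u v : Phi (u + v) = Phi u + Phi v.
  by have := lPhi 1 u v; rewrite !scale1r.
have Phi0 : Phi 0 = 0.
  by have := PhiD 0 0; rewrite addr0 => /eqP; rewrite -subr_eq0 opprD addNKr oppr_eq0 => /eqP.
have PhiZ a u : Phi (a *: u) = a * Phi u.
  by have := lPhi a u 0; rewrite !addr0 Phi0 addr0.
apply: (@hilbert_form_isomorphic R (subspace_of linS)).
apply: (@HilbertForm _ _ f _ _ _ (Num.sqrt e) (Num.sqrt (2 * K))).
- move=> x y z; rewrite /f linearD -PhiD; congr Phi.
  by Ncring_tac.non_commutative_ring.
- by move=> a x z; rewrite /f linearZ -scalerAr -scalerAl -scalerDr PhiZ.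
- by move=> x y; rewrite /f -PhiC; congr Phi; rewrite starD !starM starK.
- by rewrite sqrtr_gt0.
- by move=> x; rewrite fxx sqr_sqrtr ?(ltW e0)//; exact: phie.
- move=> x; rewrite fxx sqr_sqrtr ?mulr_ge0//=; apply: le_trans (phiK _) _.
  rewrite (mulrC 2) -mulrA ler_wpM2l// -io.
  by apply: le_trans (nrmD _ _) _; rewrite nrm_starM nrm_Mstar; lra.
- exact: subspace_complete.
Qed.
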